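(* Let $k\geq 3$ and $r\geq 2$ be integers and let $\alpha>0$. Then there exists $\varepsilon>0$ such that the following holds. Suppose $H$ is a $k$-graph on an $n$-vertex set $V$ with $\delta_{k-1}(H)\geq \alpha n$, and $p=p(n)\geq n^{-\binom{k+r-2}{k-1}^{-1}-\varepsilon}$. Let $G^{(k)}(n,p)$ be the binomial random $k$-graph on the same vertex set $V$. Then asymptotically almost surely (i.e. with probability tending to $1$ as $n\to\infty$) the union $H\cup G^{(k)}(n,p)$ contains the $r^{th}$ power of a tight Hamilton cycle.
   Context: A $k$-graph $H$ is a pair $(V(H),E(H))$ with $E(H)\subseteq\binom{V(H)}{k}$. For a $(k-1)$-subset $S\subseteq V(H)$, $\deg_H(S)$ is the number of edges containing $S$, and $\delta_{k-1}(H)$ (the minimum codegree) is the minimum of $\deg_H(S)$ over all $(k-1)$-subsets $S$. $G^{(k)}(n,p)$ is the random $k$-graph on $n$ vertices in which each $k$-subset is an edge independently with probability $p$. The union $H\cup G$ of two $k$-graphs on the same vertex set has edge set $E(H)\cup E(G)$. The $r^{th}$ power of a tight Hamilton cycle in a $k$-graph on $n$ vertices is a spanning subgraph whose vertices can be cyclically ordered so that every $k+r-1$ cyclically consecutive vertices span a complete $k$-graph $K^{(k)}_{k+r-1}$ (its edges are exactly the $k$-sets forced by this condition); ''contains'' means contains as a subgraph. *)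

(* Defs.v *)
From HB Require Import structures.
From mathcomp Require Import all_boot all_order all_algebra.
From mathcomp Require Import all_classical all_reals all_analysis.

Set Implicit Arguments.
Unset Strict Implicit.
Unset Printing Implicit Defensive.

Import Order.TTheory GRing.Theory Num.Theory.
Import numFieldNormedType.Exports.

Local Open Scope ring_scope.

Section KGraph.
Variables (k : nat) (V : finType).

Record kgraph := KGraph {
  edges :> {set {set V}};
  edges_uniform : [forall e in edges, #|e| == k] }.

HB.instance Definition _ := [isSub for edges].
HB.instance Definition _ := [Finite of kgraph by <:].

Implicit Types (H G : kgraph) (S e : {set V}).

Definition codegree H S : nat := #|[set e in edges H | S \subset e]|.

(* The default #|V| is returned only when #|V| < k - 1; otherwise it does not
   affect the minimum, since a (k-1)-set lies in at most #|V| edges. *)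
Definition min_codegree H : nat :=
  \big[minn/#|V|]_(S : {set V} | #|S| == k.-1) codegree H S.

Fact kunion_uniform H G : [forall e in edges H :|: edges G, #|e| == k].
Proof.
apply/forall_inP => e; rewrite inE => /orP[].
- exact: (forall_inP (edges_uniform H)).
- exact: (forall_inP (edges_uniform G)).
Qed.

Definition kunion H G : kgraph := KGraph (kunion_uniform H G).

Definition subgraph H G : bool := edges H \subset edges G.

(* A list s enumerating V without repetition stands for a cyclic ordering of V;
   the m cyclically consecutive vertices starting at position i are the first m
   entries of s rotated by i. *)
Definition window (s : seq V) (m i : nat) : {set V} :=
  [set x in take m (rot i s)].

Definition cycle_power_edges (r : nat) (s : seq V) : {set {set V}} :=
  [set e : {set V} | (#|e| == k) &&
     [exists i : 'I_(size s), e \subset window s (k + r - 1) i]].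

Fact cycle_power_uniform r s : [forall e in cycle_power_edges r s, #|e| == k].
Proof. by apply/forall_inP => e; rewrite inE => /andP[]. Qed.

Definition tight_cycle_power r s : kgraph := KGraph (cycle_power_uniform r s).

Definition is_tight_hamilton_cycle_power (r : nat) (F : kgraph) : bool :=
  [exists s : #|V|.-tuple V, uniq s && (F == tight_cycle_power r s)].

Definition contains_tight_hamilton_cycle_power (r : nat) (H : kgraph) : bool :=
  [exists F : kgraph, is_tight_hamilton_cycle_power r F && subgraph F H].

Section Random.
Variables (R : realType) (p : R).

Definition random_kgraph_mass (G : kgraph) : R :=
  \prod_(e : {set V} | #|e| == k) (if e \in edges G then p else 1 - p).

Definition random_kgraph_prob (A : pred kgraph) : R :=
  \sum_(G : kgraph | A G) random_kgraph_mass G.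

Lemma random_kgraph_mass_ge0 G : 0 <= p <= 1 -> 0 <= random_kgraph_mass G.
Proof.
move=> /andP[p0 p1]; apply: prodr_ge0 => e _.
by case: ifP => // _; rewrite subr_ge0.
Qed.

Lemma random_kgraph_prob_total : random_kgraph_prob predT = 1.
Proof.
pose a e : R := if #|e| == k then p else 0.
pose b e : R := if #|e| == k then 1 - p else 1.
have -> : 1 = \prod_(e : {set V}) (a e + b e).
  rewrite big1 // => e _; rewrite /a /b; case: ifP => _; last by rewrite add0r.
  by rewrite addrC subrK.
rewrite bigA_distr /= (bigID (fun J : {set {set V}} =>
  [forall e in J, #|e| == k])) /= [X in _ = _ + X]big1 ?addr0; last first.
  move=> J /forall_inPn[e eJ ek].
  by rewrite (bigD1 e) //= eJ /a (negbTE ek) mul0r.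
rewrite (reindex_omap (edges : kgraph -> _) insub) /=; last first.
  by move=> J JU; rewrite insubT.
apply: eq_big => [G|G _].
  by rewrite (edges_uniform G) (valK G) eqxx.
rewrite /random_kgraph_mass big_mkcond /=; apply: eq_bigr => e _.
rewrite /a /b; case: ifPn => // ek; case: ifPn => // eG.
by have := forall_inP (edges_uniform G) e eG; rewrite (negbTE ek).
Qed.

End Random.

End KGraph.

(* Main.v *)
Require Import Defs.
From mathcomp Require Import all_boot all_order all_algebra all_fingroup.
From mathcomp Require Import zify ring lra.

(* A second moment argument, without absorption. Write N = n.+2 for the number
   of vertices, l = k + r - 2 and d = 'C(l, k - 1), so that the power of a tight
   Hamilton cycle has d N edges. Mark a set of equally spaced blocks of k
   consecutive positions on the cycle and count the bijections phi from
   positions to vertices that send every block to an edge of H and every other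
   edge of the cycle power to an edge of G. Discarding one edge per bounded
   stretch of the cycle is what gains the factor N^-eps in p.

   The second moment is governed by the overlap of two bijections phi, phi0.
   Record it as the set of pairs (x, y) of positions with phi x = phi0 y and x
   in a common edge, and split this set into components of a bounded degree
   graph on pairs of positions. A component with v pairs carries at most
   d v - max (2 d + 1) (v / (2 M)) common edges: for small v because k >= 3
   makes the first vertices of an interval end no edge, for large v because of
   the discarded blocks. A random admissible phi realises it with probability
   O(1 / N)^v, and there are at most N^2 O(1)^v choices for it, so the expected
   weight p^-1 ^+ |overlap| is at most 1 + o(1). Only this step uses the
   codegree of H, and only to make all placements of the blocks about equally
   likely. *)

Set Implicit Arguments.
Unset Strict Implicit.
Unset Printing Implicit Defensive.

Import Order.TTheory GRing.Theory Num.Theory.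

Local Open Scope ring_scope.

(** * Components of finite sets in a bounded degree graph *)

Lemma card_bigcup_leq (I T : finType) (C : {set I}) (F : I -> {set T}) (D : nat) :
  (forall z, z \in C -> (#|F z| <= D)%N) ->
  (#|\bigcup_(z in C) F z| <= D * #|C|)%N.
Proof.
move=> FD; rewrite mulnC -sum_nat_const.
apply: (@leq_trans (\sum_(z in C) #|F z|)%N); last exact: leq_sum.
elim/big_rec2: _ => [|z n B _ IH]; first by rewrite cards0.
by rewrite (leq_trans (leq_card_setU _ _)) // leq_add2l.
Qed.

Section Components.
Variables (T : finType) (e : rel T).
Hypotheses (e_sym : symmetric e) (e_refl : reflexive e).

Implicit Types (A C N : {set T}) (x y z : T).

Definition rel_in A : rel T := [rel x y | [&& x \in A, y \in A & e x y]].
Definition component A x := [set y in A | connect (rel_in A) x y].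
Definition components A := [set component A x | x in A].
Definition connected_set C :=
  (C != set0) && [forall x in C, forall y in C, connect (rel_in C) x y].
(** As [e] is reflexive this is a closed neighbourhood, so [A :&: neighbours C = C] says that [C]
    lies in [A] and that no other element of [A] is adjacent to it. *)
Definition neighbours C := [set y | [exists z in C, e z y]].

Lemma rel_in_connect_sym A : connect_sym (rel_in A).
Proof.
by apply: sym_connect_sym => x y; rewrite /rel_in /= e_sym andbCA.
Qed.

Lemma component_refl A x : x \in A -> x \in component A x.
Proof. by move=> xA; rewrite inE xA connect0. Qed.

Lemma components_partition A : finset.partition (components A) A.
Proof.
apply: equivalence_partitionP => x y z _ _ _; split; first exact: connect0.
by move=> xy; rewrite (same_connect (@rel_in_connect_sym A) xy).
Qed.

(** A path in [A] that starts in the component never leaves it, so connection inside [A] becomes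
    connection inside the component. *)
Lemma component_connected A x : x \in A -> connected_set (component A x).
Proof.
move=> xA; set C := component A x.
have xC : x \in C by apply: component_refl.
have step p z : z \in C -> path (rel_in A) z p -> connect (rel_in C) z (last z p).
  elim: p z => [|y p IH] z zC /=; first by rewrite connect0.
  case/andP => zy yp.
  have yC : y \in C.
    move: zC zy; rewrite !inE => /andP[_ xz] zy.
    case/and3P: (zy) => _ -> _ /=.
    exact: connect_trans xz (connect1 zy).
  apply: connect_trans (IH y yC yp); apply: connect1.
  by apply/and3P; split=> //; case/and3P: zy.
have reach y : y \in C -> connect (rel_in C) x y.
  rewrite inE => /andP[_ /connectP[p px ->]]; exact: step.
apply/andP; split; first by apply/set0Pn; exists x.
apply/forall_inP => y yC; apply/forall_inP => z zC.
apply: connect_trans (reach z zC); rewrite rel_in_connect_sym; exact: reach.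
Qed.

(** No path of [A] can step out of [C], and connectedness of [C] lets paths from [x] reach all of
    it. *)
Lemma component_of_connected A C x :
  connected_set C -> x \in C -> A :&: neighbours C = C -> component A x = C.
Proof.
move=> /andP[_ /forall_inP connC] xC AN.
have CA : C \subset A by rewrite -AN subsetIl.
apply/setP => y; rewrite inE; apply/andP/idP => [[yA /connectP[p px ->]]|yC].
  elim: p x xC px => [|z p IH] x xC //= /andP[/and3P[_ zA xz] zp].
  apply: IH => //; rewrite -AN inE zA inE; apply/exists_inP; by exists x.
split; first exact: (subsetP CA).
move/forall_inP: (connC x xC) => /(_ y yC).
apply: connect_sub => u v /and3P[uC vC uv]; apply: connect1.
by apply/and3P; split=> //; apply: (subsetP CA).
Qed.

(** Outside [N] the set is free: every [C :|: B] with [B] disjoint from [N] qualifies, and [B] can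
    be recovered from it. *)
Lemma card_setI_eq N C :
  C \subset N -> (2 ^ (#|T| - #|N|) <= #|[set A : {set T} | A :&: N == C]|)%N.
Proof.
move=> CN; have -> : (#|T| - #|N|)%N = #|~: N| by rewrite -(cardsC N) addKn.
rewrite -card_powerset -(@card_in_imset _ _ (fun B => C :|: B)); last first.
  move=> B B'; rewrite !inE => BN BN' eqCB.
  have K (D : {set T}) : D \subset ~: N -> D = (C :|: D) :&: ~: N.
    move=> DN; rewrite finset.setIUl (setIidPl DN).
    suff -> : C :&: ~: N = set0 by rewrite set0U.
    by apply/eqP; rewrite setI_eq0 disjoints_subset setCK.
  by rewrite (K _ BN) (K _ BN') eqCB.
apply: subset_leq_card; apply/subsetP => A /imsetP[B]; rewrite !inE => BN ->.
rewrite finset.setIUl (setIidPl CN).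
suff -> : B :&: N = set0 by rewrite setU0.
by apply/eqP; rewrite setI_eq0 disjoints_subset.
Qed.

(* For a fixed x, the families {A | A :&: neighbours C = C}, with C connected
   and containing x, are disjoint because each such A has C as its component
   at x. *)
Lemma sum_connected_pow2 x :
  (\sum_(C : {set T} | connected_set C && (x \in C))
     2 ^ (#|T| - #|neighbours C|) <= 2 ^ #|T|)%N.
Proof.
have subN C : C \subset neighbours C.
  by apply/subsetP => y yC; rewrite inE; apply/exists_inP; exists y.
apply: (@leq_trans (\sum_(C : {set T} | connected_set C && (x \in C))
   #|[set A : {set T} | A :&: neighbours C == C]|)%N).
  by apply: leq_sum => C _; apply: card_setI_eq.
have -> : (2 ^ #|T| = \sum_(A : {set T}) 1)%N.
  by rewrite sum1_card -[RHS]cardsT -powersetT card_powerset cardsT.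
under eq_bigr => C _ do rewrite -sum1dep_card big_mkcond /=.
rewrite exchange_big /=; apply: leq_sum => A _.
rewrite -big_mkcondr /= sum1dep_card.
rewrite -(cards1 (component A x)); apply: subset_leq_card.
apply/subsetP => C; rewrite !inE => /andP[/andP[cC xC] /eqP AN].
by rewrite (component_of_connected cC xC AN).
Qed.

(** The expanded product runs over all families of connected sets. A set is the union of its
    components, so the left side is part of this sum of nonnegative terms. *)
Lemma sum_prod_components (R : numDomainType) (w : {set T} -> R) :
  (forall C, 0 <= w C) ->
  \sum_(A : {set T}) \prod_(C in components A) w C
    <= \prod_(C : {set T} | connected_set C) (1 + w C).
Proof.
move=> w0; pose a C := if connected_set C then w C else 0.
have a0 C : 0 <= a C by rewrite /a; case: ifP.
have compI : injective components.
  move=> A B eqAB; rewrite -(cover_partition (components_partition A)) eqAB.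
  exact: cover_partition (components_partition B).
have -> : \prod_(C : {set T} | connected_set C) (1 + w C) =
          \prod_(C : {set T}) (a C + 1).
  rewrite big_mkcond /=; apply: eq_bigr => C _; rewrite /a.
  by case: ifP => _; rewrite ?add0r // addrC.
rewrite bigA_distr /=.
have eqw A : \prod_(C in components A) w C =
    \prod_C (if C \in components A then a C else 1).
  rewrite [LHS]big_mkcond /=; apply: eq_bigr => C _; case: ifP => // /imsetP[x xA ->].
  by rewrite /a component_connected.
under eq_bigr => A _ do rewrite eqw.
pose g (J : {set {set T}}) := \prod_C (if C \in J then a C else 1).
rewrite -(big_imset g) /=; last by move=> ? ? _ _; apply: compI.
rewrite [leLHS]big_mkcond /= [leRHS]big_mkcond /=.
apply: ler_sum => J _ /=; case: ifP => // _.
by apply: prodr_ge0 => C _; case: ifP.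
Qed.

(** Since [#|neighbours C| <= D * #|C|], the weights [2 ^- (D * #|C|)] of the connected sets through
    a given point sum to at most 1. What remains of [kap ^+ #|C|] is a power of [kap * 2 ^+ D],
    which is at most its first power. Summing over the point counts each connected set at least
    once. *)
Lemma sum_connected_weight (R : realFieldType) (D : nat) (kap : R) :
  (forall x, (#|[set y | e x y]| <= D)%N) ->
  0 <= kap -> kap * 2 ^+ D <= 1 ->
  \sum_(C : {set T} | connected_set C) kap ^+ #|C|
    <= #|T|%:R * (kap * 2 ^+ D).
Proof.
move=> degD kap0 kapD.
have two0 n : 0 < 2 ^+ n :> R by rewrite exprn_gt0.
have cardN C : (#|neighbours C| <= D * #|C|)%N.
  have -> : neighbours C = \bigcup_(z in C) [set y | e z y].
    apply/setP => y; rewrite inE; apply/exists_inP/bigcupP => -[z zC h]; exists z => //.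
      by rewrite inE.
    by move: h; rewrite inE.
  by apply: card_bigcup_leq => z _; apply: degD.
have weight1 x : \sum_(C : {set T} | connected_set C && (x \in C))
    (2 ^+ (D * #|C|))^-1 <= 1 :> R.
  have := sum_connected_pow2 x; rewrite -(ler_nat R) natr_sum natrX => le2.
  rewrite -(ler_pM2l (two0 #|T|)) mulr1 (le_trans _ le2) // mulr_sumr.
  apply: ler_sum => C _; rewrite ler_pdivrMr // natrX -exprD.
  rewrite ler_eXn2l ?ltr1n // -leq_subLR.
  by rewrite subKn ?max_card.
pose eta := kap * 2 ^+ D.
have powE n : kap ^+ n = eta ^+ n * (2 ^+ (D * n))^-1.
  by rewrite /eta exprMn -exprM mulfK // gt_eqF.
apply: (@le_trans _ _ (\sum_(x : T) \sum_(C : {set T} | connected_set C && (x \in C))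
    eta * (2 ^+ (D * #|C|))^-1)).
  under [leRHS]eq_bigr => x _ do rewrite big_mkcondr /=.
  rewrite exchange_big /=; apply: ler_sum => C /andP[/set0Pn[x xC] _].
  have ge0 (y : T) : 0 <= (if y \in C then eta * (2 ^+ (D * #|C|))^-1 else 0).
    case: ifP => // _; apply: mulr_ge0; first by rewrite mulr_ge0 // ltW.
    by rewrite invr_ge0 ltW.
  rewrite (bigD1 x) //= xC powE -[leLHS]addr0 lerD ?sumr_ge0 //.
  rewrite ler_wpM2r ?invr_ge0 ?(ltW (two0 _)) //.
  have : (0 < #|C|)%N by rewrite card_gt0; apply/set0Pn; exists x.
  by move=> ?; rewrite ler_iXnr // /eta mulr_ge0 // ltW.
rewrite mulrC mulr_natr -sumr_const; apply: ler_sum => x _.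
by rewrite -mulr_sumr -[leRHS]mulr1 ler_wpM2l // mulr_ge0 // ltW.
Qed.

End Components.

(** * Edges of the cycle power inside a set of positions *)

Section CyclicWindows.
Variables (n k l M : nat).
Local Notation Z := 'I_n.+2.
Implicit Types (f X : {set Z}) (x y z i : Z).

(** Addition in ['I_n.+2] is modulo [n.+2], so positions are cyclic. For [l = k + r - 2] an arc is
    the window of [k + r - 1] consecutive positions. *)
Definition arc i : {set Z} := [set i + (j : nat)%:R | j : 'I_l.+1].
Definition left_arc x : {set Z} := [set x - j.+1%:R | j : 'I_l].
Definition block z : {set Z} := [set z - (j : nat)%:R | j : 'I_k].
(** The residue [k.-1] keeps a block, which extends to the left of its end, from wrapping around
    position 0. *)
Definition block_ends : {set Z} := [set z : Z | z %% M == k.-1]%N.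
Definition cyclic_edges : {set {set Z}} :=
  [set f : {set Z} | (#|f| == k) && [exists i, f \subset arc i]].
Definition free_edges := cyclic_edges :\: [set block z | z in block_ends].
Definition edges_in X := [set f in free_edges | f \subset X].
(** The edges whose last vertex is [x]. When the cycle is short compared with [l], an edge may end
    at several positions, so summing over [x] gives only an upper bound on the number of edges. *)
Definition edges_ending X x :=
  [set f in edges_in X | (x \in f) && (f :\ x \subset left_arc x)].
Definition near_arc x y := [exists i, (x \in arc i) && (y \in arc i)].

Lemma val_natr_ord m : (m%:R : Z) = (m %% n.+2)%N :> nat.
Proof. exact: (@val_Zp_nat n.+2). Qed.

Lemma natr_ord_inj a b : (a < n.+2)%N -> (b < n.+2)%N ->
  a%:R = b%:R :> Z -> a = b.
Proof.
by move=> an bn /(congr1 val) /=; rewrite !val_natr_ord !modn_small.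
Qed.

Lemma val_subr_natr x j : (j <= x)%N -> (x - j%:R : Z) = (x - j)%N :> nat.
Proof.
move=> jx; rewrite -{1}[x]natr_Zp -natrB // val_natr_ord modn_small //.
by rewrite (leq_ltn_trans (leq_subr _ _)).
Qed.

Lemma near_arc_refl : reflexive near_arc.
Proof.
move=> x; apply/existsP; exists x; rewrite andbb; apply/imsetP.
by exists ord0; rewrite // addr0.
Qed.

Lemma near_arc_sym : symmetric near_arc.
Proof. by move=> x y; apply: eq_existsb => i; rewrite andbC. Qed.

Lemma card_near_arc x : (#|[set y | near_arc x y]| <= l.+1 * l.+1)%N.
Proof.
rewrite -{1 2}(card_ord l.+1) -card_prod.
pose g (u : 'I_l.+1 * 'I_l.+1) : Z := x - (u.1 : nat)%:R + (u.2 : nat)%:R.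
apply: leq_trans (leq_imset_card g _); apply: subset_leq_card.
apply/subsetP => y; rewrite inE => /existsP[i /andP[/imsetP[j _ Ex] /imsetP[j' _ ->]]].
by apply/imsetP; exists (j, j'); rewrite // /g /= Ex addrK.
Qed.

(** The last vertex is the one of largest offset in an arc containing [f]. *)
Lemma edge_end f : (0 < k)%N -> f \in cyclic_edges ->
  exists2 x, x \in f & f :\ x \subset left_arc x.
Proof.
move=> k0; rewrite inE => /andP[/eqP fk /existsP[i /subsetP fi]].
have [y0 y0f] : exists y, y \in f by apply/set0Pn; rewrite -card_gt0 fk.
have /imsetP[j0 _ Ey0] := fi _ y0f.
have j0f : i + (j0 : nat)%:R \in f by rewrite -Ey0.
have [j jf jmax] := @arg_maxnP _ j0 (fun j : 'I_l.+1 => i + (j : nat)%:R \in f) val j0f.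
exists (i + (j : nat)%:R) => //; apply/subsetP => y; rewrite !inE => /andP[yj yf].
have /imsetP[j' _ Ey] := fi _ yf.
have j'j : (j' <= j)%N by apply: jmax; rewrite -Ey.
have j'nj : j' != j by apply: contraNneq yj => <-; rewrite Ey.
have lt : (j' < j)%N by rewrite ltn_neqAle j'j andbT.
have lt2 : ((j - j').-1 < l)%N by have := ltn_ord j; lia.
apply/imsetP; exists (Ordinal lt2) => //=.
by rewrite prednK ?subn_gt0 // natrB // Ey; ring.
Qed.

Lemma card_left_arc x : (#|left_arc x| <= l)%N.
Proof. by apply: leq_trans (leq_imset_card _ _) _; rewrite card_ord. Qed.

Lemma setD1_inj_in x : {in [set f : {set Z} | x \in f] &, injective (fun f => f :\ x)}.
Proof.
by move=> f g; rewrite !inE => xf xg fg; rewrite -(setD1K xf) fg setD1K.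
Qed.

Lemma card_edges_ending X x :
  (#|edges_ending X x| <= 'C(#|left_arc x :&: X|, k.-1))%N.
Proof.
rewrite -cards_draws -[leqLHS](@card_in_imset _ _ (fun f => f :\ x)); last first.
  move=> f g; rewrite inE => /andP[_ /andP[xf _]]; rewrite inE => /andP[_ /andP[xg _]].
  by apply: setD1_inj_in; rewrite inE.
apply: subset_leq_card; apply/subsetP => h /imsetP[f].
rewrite !inE => /andP[/andP[/andP[_ /andP[/eqP fk _]] fX] /andP[xf fL]] ->.
rewrite subsetI fL (subset_trans (subD1set _ _) fX) /=.
by rewrite -fk (cardsD1 x f) xf.
Qed.

Lemma card_edges_ending_le X x : (#|edges_ending X x| <= 'C(l, k.-1))%N.
Proof.
apply: leq_trans (card_edges_ending X x) _; apply: leq_bin2l.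
exact: leq_trans (subset_leq_card (subsetIl _ _)) (card_left_arc x).
Qed.

Lemma card_edges_in_le_sum X : (0 < k)%N ->
  (#|edges_in X| <= \sum_(x in X) #|edges_ending X x|)%N.
Proof.
move=> k0; have -> : edges_in X = \bigcup_(x in X) edges_ending X x.
  apply/setP => f; apply/idP/bigcupP => [fX|[x _]]; last by rewrite inE => /andP[].
  have := fX; rewrite inE => /andP[]; rewrite inE => /andP[_ fc] fsub.
  have [x xf fL] := edge_end k0 fc.
  by exists x; rewrite ?(subsetP fsub) // inE fX xf.
elim/big_rec2: _ => [|z m B _ IH]; first by rewrite cards0.
by rewrite (leq_trans (leq_card_setU _ _)) // leq_add2l.
Qed.

Hypothesis k3 : (3 <= k)%N.

Lemma block_refl z : z \in block z.
Proof.
have k0 : (0 < k)%N by lia.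
by apply/imsetP; exists (Ordinal k0); rewrite //= subr0.
Qed.

Hypothesis kM : (k <= M)%N.

(** Two ends are congruent modulo [M], while positions of one block differ by less than [k <= M]; no
    wrap-around interferes because an end is at least [k.-1]. *)
Lemma block_end_notin z z' :
  z \in block_ends -> z' \in block_ends -> z != z' -> z \notin block z'.
Proof.
rewrite !inE => /eqP Ez /eqP Ez'; apply: contra => /imsetP[j _ E].
have jk := ltn_ord j.
have z'k : (k.-1 <= z')%N by rewrite -Ez' leq_mod.
have jz' : (j <= z')%N by lia.
have vz : (z : nat) = (z' - j)%N by rewrite E val_subr_natr.
have j0 : (j : nat) = 0%N.
  have := divn_eq z' M; rewrite Ez' => D.
  have := Ez; rewrite vz (_ : (z' - j = z' %/ M * M + (k.-1 - j))%N); last by lia.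
  by rewrite modnMDl modn_small; lia.
by rewrite E j0 subr0.
Qed.

Lemma card_block_ends : (#|block_ends| <= (n.+2 %/ M).+1)%N.
Proof.
have M0 : (0 < M)%N by lia.
have lt z : (z %/ M < (n.+2 %/ M).+1)%N.
  by rewrite ltnS leq_div2r // ltnW.
rewrite -[leqRHS]card_ord -[leqLHS](@card_in_imset _ _ (fun z => Ordinal (lt z))).
  exact: max_card.
move=> z z'; rewrite !inE => /eqP Ez /eqP Ez' /(congr1 val) /= E.
by apply: val_inj; rewrite /= (divn_eq z M) (divn_eq z' M) Ez Ez' E.
Qed.

Hypothesis MN : (2 * M <= n.+2)%N.

Lemma block_end_near x :
  exists2 j, (j < 2 * M)%N & x - j%:R \in block_ends.
Proof.
have val_ends y : (k.-1 <= y)%N -> y - ((y - k.-1) %% M)%:R \in block_ends.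
  move=> ky; set j := ((y - k.-1) %% M)%N.
  have jy : (j <= y)%N by apply: leq_trans (leq_mod _ _) (leq_subr _ _).
  rewrite inE val_subr_natr //.
  have E := divn_eq (y - k.-1) M; rewrite -/j in E.
  have -> : (y - j = (y - k.-1) %/ M * M + k.-1)%N by lia.
  by rewrite modnMDl modn_small //; lia.
case: (leqP k.-1 x) => kx.
  exists ((x - k.-1) %% M)%N; last exact: val_ends.
  by rewrite (leq_trans (ltn_pmod _ _)) //; lia.
(* Here [x] precedes every block end. Going back [x.+1 < k] steps leads around the cycle to [n.+1],
   from where fewer than [M] further steps suffice; hence the bound [2 * M]. *)
have last_eq : x - x.+1%:R = (n.+1%:R : Z).
  rewrite -{1}[x]natr_Zp -[in LHS]natr1 opprD addrA subrr sub0r.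
  apply/eqP; rewrite eq_sym -subr_eq0 opprK natr1; apply/eqP.
  by apply: val_inj; rewrite [LHS]val_natr_ord modnn.
have vl : (n.+1%:R : Z) = n.+1 :> nat by rewrite val_natr_ord modn_small.
exists (x.+1 + ((n.+1 - k.-1) %% M))%N.
  have : ((n.+1 - k.-1) %% M < M)%N by rewrite ltn_pmod //; lia.
  by lia.
rewrite natrD opprD addrA last_eq.
by have := val_ends n.+1%:R; rewrite vl; apply; lia.
Qed.

Lemma card_block z : #|block z| = k.
Proof.
rewrite card_imset ?card_ord // => j j' /addrI/oppr_inj E; apply: val_inj.
by apply: natr_ord_inj E; have := ltn_ord j; have := ltn_ord j'; lia.
Qed.

Hypothesis kl : (k <= l)%N.

Lemma block_left_arc z : block z :\ z \subset left_arc z.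
Proof.
apply/subsetP => y; rewrite !inE => /andP[yz /imsetP[[[|j] jk] _ E]].
  by rewrite E subr0 eqxx in yz.
have jl : (j < l)%N by lia.
by apply/imsetP; exists (Ordinal jl).
Qed.

(** The block itself is an edge with last vertex [z] but is not free, so one of the ['C(l, k.-1)]
    candidates is always missing. *)
Lemma edges_ending_block_end X z : z \in block_ends ->
  (#|edges_ending X z| < 'C(l, k.-1))%N.
Proof.
move=> ze; set D := [set A : {set Z} | A \subset left_arc z & #|A| == k.-1].
have bD : block z :\ z \in D.
  rewrite inE block_left_arc andTb; apply/eqP.
  by move: (card_block z); rewrite (cardsD1 z) block_refl add1n => <-.
have : (#|D| <= 'C(l, k.-1))%N.
  by rewrite cards_draws leq_bin2l // card_left_arc.
apply: leq_trans; rewrite (cardsD1 (block z :\ z) D) bD add1n ltnS.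
rewrite -[leqLHS](@card_in_imset _ _ (fun f => f :\ z)); last first.
  move=> f g; rewrite inE => /andP[_ /andP[xf _]]; rewrite inE => /andP[_ /andP[xg _]].
  by apply: setD1_inj_in; rewrite inE.
apply: subset_leq_card; apply/subsetP => h /imsetP[f].
rewrite !inE => /andP[/andP[/andP[fb /andP[/eqP fk _]] fX] /andP[xf fL]] ->.
rewrite fL andTb -fk (cardsD1 z f) xf eqxx andbT.
apply: contra fb => /eqP E; apply/imsetP; exists z => //.
apply: (@setD1_inj_in z); [by rewrite inE| |exact: E].
by rewrite inE; exact: block_refl.
Qed.

(** With a position of the left arc missing, at most ['C(l.-1, k.-1)] edges end at [x], and by
    Pascal's rule this is strictly less. *)
Lemma left_arc_sub_of_full X x :
  #|edges_ending X x| = 'C(l, k.-1) -> left_arc x \subset X.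
Proof.
move=> full; have := card_edges_ending X x; rewrite full => le.
have lle : (l <= #|left_arc x :&: X|)%N.
  rewrite leqNgt; apply/negP => lt.
  have : ('C(l, k.-1) <= 'C(l.-1, k.-1))%N.
    by apply: leq_trans le _; apply: leq_bin2l; lia.
  have -> : l = l.-1.+1 by lia.
  have -> : k.-1 = k.-2.+1 by lia.
  rewrite binS /= -{2}[('C(_, _))]addn0 leq_add2l leqn0 => /eqP.
  by apply/eqP; rewrite -lt0n bin_gt0; lia.
have : left_arc x :&: X == left_arc x.
  by rewrite eqEcard subsetIl (leq_trans (card_left_arc x)).
by move/eqP/setIidPl.
Qed.

(** Call [x] full if [d] edges end at it. A full position has its left neighbour in [X], so walking
    left from any point of [X] stays in [X] until a position that is not full, met within [2 * M]
    steps because block ends are never full. Hence at least [#|X| / (2 * M)] points of [X] end fewer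
    than [d] edges. *)
Lemma card_edges_in X :
  (2 * M * #|edges_in X| + #|X| <= 2 * M * 'C(l, k.-1) * #|X|)%N.
Proof.
set d := 'C(l, k.-1).
pose NF := [set x in X | #|edges_ending X x| < d]%N.
have notfull x : x \in X -> exists2 j, (j < 2 * M)%N & x - j%:R \in NF.
  move=> xX; have [m mM mE] := block_end_near x.
  case: (boolP [exists j : 'I_(2 * M), x - (j : nat)%:R \in NF]).
    by case/existsP => j jN; exists j.
  rewrite negb_exists => /forallP noNF.
  have inX j : (j < 2 * M)%N -> x - j%:R \in X.
    elim: j => [_|j IH jM]; first by rewrite subr0.
    have jX := IH (ltnW jM).
    have := noNF (Ordinal (ltnW jM)); rewrite inE /= jX /= -leqNgt => ge.
    have full : #|edges_ending X (x - j%:R)| = d.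
      by apply/eqP; rewrite eqn_leq ge card_edges_ending_le.
    apply: (subsetP (left_arc_sub_of_full full)).
    have l0 : (0 < l)%N by lia.
    by apply/imsetP; exists (Ordinal l0); rewrite //= -natr1 opprD addrA.
  exists m => //; rewrite inE inX //=; exact: edges_ending_block_end.
have cardX : (#|X| <= 2 * M * #|NF|)%N.
  have -> : (2 * M * #|NF|)%N = #|finset.setX [set: 'I_(2 * M)] NF|.
    by rewrite cardsX cardsT card_ord.
  pose g (u : 'I_(2 * M) * Z) := u.2 + (u.1 : nat)%:R.
  apply: leq_trans (leq_imset_card g _); apply: subset_leq_card.
  apply/subsetP => x xX; have [j jM jN] := notfull x xX.
  apply/imsetP; exists (Ordinal jM, x - j%:R); last by rewrite /g /= subrK.
  by rewrite !inE /= in jN *.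
have k0 : (0 < k)%N by lia.
have sum_le : (\sum_(x in X) #|edges_ending X x| + #|NF| <= d * #|X|)%N.
  have -> : #|NF| = (\sum_(x in X) (#|edges_ending X x| < d))%N.
    rewrite -sum1_card big_mkcond [RHS]big_mkcond; apply: eq_bigr => x _.
    by rewrite inE; case: (x \in X) => //=; case: (_ < _)%N.
  rewrite -big_split /= mulnC -sum_nat_const; apply: leq_sum => x xX.
  have := card_edges_ending_le X x; rewrite -/d leq_eqVlt.
  by case/predU1P => [->|lt]; rewrite ?ltnn ?addn0 // lt addn1.
have := card_edges_in_le_sum X k0; move: cardX sum_le.
set S := (\sum_(x in X) _)%N; set a := #|NF|; set b := #|X|; set c := #|edges_in X|.
move=> h1 h2 h3.
have h4 : (2 * M * (c + a) <= 2 * M * (d * b))%N.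
  by rewrite leq_mul2l (leq_trans _ h2) ?orbT // leq_add2r.
rewrite mulnA in h4; apply: leq_trans h4.
by rewrite mulnDr leq_add2l.
Qed.

(** A cyclic order has no last element, but a sparse [X] contains a point followed by [l] positions
    outside [X], which serves as one. *)
Lemma last_vertex X : X != set0 -> (l * #|X| < n.+2)%N ->
  exists2 x, x \in X & forall y, y \in X -> x \notin left_arc y.
Proof.
move=> /set0Pn[x0 x0X] small.
case: (boolP [exists x in X, [forall y in X, x \notin left_arc y]]).
  by case/exists_inP => x xX /forall_inP h; exists x.
move/exists_inPn => h.
have {}h x : x \in X -> exists2 y, y \in X & x \in left_arc y.
  by move=> /h /forall_inPn[y yX /negPn]; exists y.
(* Every cyclic interval of length l meets X, so X is not sparse. *)
have meet m : exists2 j, (j < l)%N & x0 + m%:R - j%:R \in X.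
  elim: m => [|m [j jl jX]]; first by exists 0%N; rewrite ?addr0 ?subr0 //; lia.
  case: (leqP j.+1 l.-1) => jl'.
    exists j.+1; first by lia.
    by rewrite (_ : _ - _ = x0 + m%:R - j%:R) // -!natr1; ring.
  (* Now [j = l.-1]: the point of [X] found so far leaves the interval, and a point of [X] whose
     left arc contains it takes its place. *)
  have [y yX /imsetP[i _ E]] := h _ jX.
  have il := ltn_ord i.
  exists (j - i)%N; first by lia.
  suff -> : x0 + m.+1%:R - (j - i)%:R = y by [].
  have ij : (i <= j)%N by lia.
  have -> : y = (x0 + m%:R - j%:R) + i.+1%:R by rewrite E subrK.
  rewrite natrB // -!natr1; ring.
have cover : (#|{: Z}| <= l * #|X|)%N.
  have -> : (l * #|X|)%N = #|finset.setX [set: 'I_l] X| by rewrite cardsX cardsT card_ord.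
  rewrite -cardsT.
  pose g (u : 'I_l * Z) := u.2 + (u.1 : nat)%:R.
  apply: leq_trans (leq_imset_card g _); apply: subset_leq_card.
  apply/subsetP => y _; have [j jl jX] := meet (y - x0 : Z).
  move: jX; rewrite natr_Zp [x0 + _]addrC subrK => jX.
  by apply/imsetP; exists (Ordinal jl, y - j%:R); rewrite ?inE // /g /= subrK.
by rewrite card_ord leqNgt small in cover.
Qed.

(** Deleting the last vertex loses at most [d] edges, so induction descends to three vertices. These
    span at most one edge as [k >= 3], and [d >= 3] leaves room for the slack [2 * d + 1]. *)
Lemma card_edges_in_small X : (3 <= #|X|)%N -> (l * #|X| < n.+2)%N ->
  (#|edges_in X| + 2 * 'C(l, k.-1) + 1 <= 'C(l, k.-1) * #|X|)%N.
Proof.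
set d := 'C(l, k.-1).
have d3 : (3 <= d)%N.
  apply: leq_trans k3 _; rewrite /d -[k in (k <= _)%N](@prednK k) ?(ltnW (ltnW k3)) //.
  by rewrite -[X in (X <= _)%N]binSn leq_bin2l // prednK //; lia.
have [v] := ubnP #|X|; elim: v X => // v IH X vX X3 small.
case: (leqP 4 #|X|) => X4; last first.
  have EX : #|X| = 3%N by lia.
  have : (#|edges_in X| <= 'C(3, k))%N.
    rewrite -EX -cards_draws; apply: subset_leq_card; apply/subsetP => f.
    by rewrite !inE => /andP[/andP[_ /andP[-> _]] ->].
  have : ('C(3, k) <= 1)%N.
    by case: (ltnP 3 k) => h; [rewrite bin_small | rewrite (_ : k = 3%N) //; lia].
  by rewrite EX; lia.
have X0 : X != set0 by rewrite -card_gt0; lia.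
have [x xX lastx] := last_vertex X0 small.
have cX := cardsD1 x X; rewrite xX /= in cX.
have k0 : (0 < k)%N by lia.
have le : (#|edges_in X| <= #|edges_in (X :\ x)| + #|edges_ending X x|)%N.
  apply: leq_trans (leq_card_setU _ _); apply: subset_leq_card.
  apply/subsetP => f fX; rewrite !in_setU.
  have := fX; rewrite inE => /andP[ff fsub].
  case: (boolP (x \in f)) => xf; last first.
    by rewrite inE ff subsetD1 fsub xf.
  apply/orP; right; rewrite inE fX xf /=.
  have fc : f \in cyclic_edges by move: ff; rewrite inE => /andP[].
  have [y yf fy] := edge_end k0 fc.
  (* An edge containing [x] must end at [x], since [x] is in the left arc of no vertex of [X]. *)
  case: (eqVneq x y) => [->//|xy].
  have : x \in left_arc y by apply: (subsetP fy); rewrite !inE xy.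
  by rewrite (negbTE (lastx y (subsetP fsub _ yf))).
have := card_edges_ending_le X x; rewrite -/d => le2.
rewrite cX in small vX X4 *.
have lX : (l * #|X :\ x| < n.+2)%N.
  by apply: leq_ltn_trans small; rewrite leq_mul2l leq_addl orbT.
rewrite !add1n !ltnS in vX X4.
move: (IH _ vX X4 lX); rewrite mulnDr muln1 => IHx.
apply: leq_trans (leq_add le2 IHx); rewrite !addnA.
by rewrite !leq_add2r addnC.
Qed.

End CyclicWindows.

(** * Random placements of the blocks *)

(** Bernoulli's inequality: [(1 - 1 / m.+1) ^ h] is at least [1 - h / m.+1], hence at least one
    half. *)
Lemma expSn_le_half m h : (2 * h <= m.+1)%N -> (m.+1 ^ h <= 2 * m ^ h)%N.
Proof.
have bern j : (j <= m.+1)%N -> (m.+1 ^ j * (m.+1 - j) <= m.+1 * m ^ j)%N.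
  elim: j => [|j IH] jm; first by rewrite !expn0 subn0 mul1n muln1.
  have {IH} := IH (ltnW jm); rewrite subSS !expnS => IH.
  apply: (@leq_trans (m * (m.+1 ^ j * (m.+1 - j)))%N).
    rewrite -mulnA mulnCA [leqRHS]mulnCA leq_mul2l; apply/orP; right; nia.
  by rewrite [X in (_ <= X)%N]mulnCA leq_mul2l IH orbT.
move=> hm; have hm' : (h <= m.+1)%N by lia.
have := bern h hm'.
set x := (m.+1 ^ h)%N; set y := (m ^ h)%N; nia.
Qed.

Lemma expSn_le4 m v : (v <= m)%N -> (m.+1 ^ v <= 4 * m ^ v)%N.
Proof.
move=> vm; pose h := v./2.
have h1 : (m.+1 ^ h <= 2 * m ^ h)%N by apply: expSn_le_half; rewrite /h; lia.
have h2 : (m.+1 ^ (v - h) <= 2 * m ^ (v - h))%N.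
  by apply: expSn_le_half; rewrite /h; lia.
have hv : (h <= v)%N by rewrite /h; lia.
rewrite -(subnKC hv) !expnD (leq_trans (leq_mul h1 h2)) //.
by rewrite mulnACA.
Qed.

(** The bound holds up to [v = a]: it is applied to sets of prescribed positions about whose size
    nothing better is known. *)
Lemma ffact_ge a v : (v <= a)%N -> (a ^ v <= 4 ^ v * a ^_ v)%N.
Proof.
elim: v a => [|v IH] [|m] //= vm; rewrite ffactSS.
apply: (@leq_trans (m.+1 * (4 * m ^ v))%N).
  by rewrite expnS leq_mul2l expSn_le4 // orbT.
have := IH m vm => h.
rewrite expnS -mulnA mulnCA leq_mul2l /= mulnCA leq_mul2l; exact: h.
Qed.

Section Placements.
Variables (k : nat) (Z V : finType) (H : kgraph k V).
Variables (B : Z -> {set Z}) (E : {set Z}).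
Implicit Types (phi : {ffun Z -> V}) (A D J : {set Z}) (x y z w : Z).

Definition swap phi x y : {ffun Z -> V} := [ffun z => phi (tperm x y z)].

Definition placements J : {set {ffun Z -> V}} :=
  [set phi : {ffun Z -> V} |
     injectiveb phi && [forall z in J, phi @: B z \in edges H]].

Definition covered J := \bigcup_(z in J) B z.

Lemma swapK x y : involutive (fun phi => swap phi x y).
Proof. by move=> phi; apply/ffunP => z; rewrite !ffunE tpermK. Qed.

Lemma swap_inj phi x y : injective phi -> injective (swap phi x y).
Proof. by move=> pI z w; rewrite !ffunE => /pI/perm_inj. Qed.

Lemma swap_imset phi x y A : x \notin A -> y \notin A ->
  swap phi x y @: A = phi @: A.
Proof.
move=> xA yA; apply: eq_in_imset => z zA; rewrite ffunE tpermD //.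
  by apply: contraNneq xA => ->.
by apply: contraNneq yA => ->.
Qed.

Section Fixing.
Variable Psi : {set {ffun Z -> V}}.
Hypothesis Psi_inj : forall phi, phi \in Psi -> injective phi.

Definition swap_closed (Q : {set {ffun Z -> V}}) A :=
  forall phi x y, phi \in Q -> x \notin A -> y \notin A -> swap phi x y \in Q.

(** Swapping [x] with any [z] outside [A] stays in [Psi], and the pair is recovered from the result:
    [z] is the position where the new map takes the value [v]. *)
Lemma card_fix_one A x v : swap_closed Psi A -> x \notin A ->
  (#|[set phi in Psi | phi x == v]| * #|~: A| <= #|Psi|)%N.
Proof.
move=> closed xA; rewrite -cardsX.
rewrite -[leqLHS](@card_in_imset _ _ (fun u => swap u.1 x u.2)).
  apply: subset_leq_card; apply/subsetP => phi /imsetP[[psi z]].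
  rewrite !inE /= => /andP[/andP[psiP _] zA] ->.
  exact: closed.
move=> [f z] [g w]; rewrite !inE /= => /andP[/andP[fP /eqP fx] _].
move=> /andP[/andP[gP /eqP gx] _] E1.
have zw : z = w.
  apply: (swap_inj (x := x) (y := z) (Psi_inj fP)).
  by rewrite [in RHS](E1 : swap f x z = swap g x w) !ffunE !tpermR fx gx.
by move: E1; rewrite zw => /(can_inj (swapK x w)) ->.
Qed.
End Fixing.

(** The positions of [D] are fixed one at a time, each then joining the set [A] that swaps must
    avoid; the shrinking complement produces the falling factorial. *)
Lemma card_fix (Psi : {set {ffun Z -> V}}) A D (g : Z -> V) :
  (forall phi, phi \in Psi -> injective phi) ->
  swap_closed Psi A -> [disjoint D & A] ->
  (#|[set phi in Psi | [forall x in D, phi x == g x]]| * #|~: A| ^_ #|D|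
     <= #|Psi|)%N.
Proof.
have [v] := ubnP #|D|; elim: v D A Psi => // v IH D A Psi vD PI closed dis.
have [->|[x xD]] := set_0Vmem D.
  rewrite cards0 ffactn0 muln1; apply: subset_leq_card.
  by apply/subsetP => phi; rewrite inE => /andP[].
have xA : x \notin A by rewrite (disjointFr dis xD).
pose Psi' := [set phi in Psi | phi x == g x].
have cD : #|D| = #|D :\ x|.+1 by rewrite (cardsD1 x) xD.
have cA : #|~: A| = #|~: (x |: A)|.+1.
  by rewrite (cardsD1 x) inE xA add1n setDE finset.setCU finset.setIC.
have closed' : swap_closed Psi' (x |: A).
  move=> phi y z; rewrite !inE !negb_or => /andP[pP px] /andP[yx yA] /andP[zx zA].
  by rewrite closed //= ffunE tpermD.
have dis' : [disjoint D :\ x & x |: A].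
  rewrite disjoint_subset; apply/subsetP => y; rewrite !inE => /andP[yx yD].
  by rewrite negb_or yx (disjointFr dis yD).
have PI' phi : phi \in Psi' -> injective phi by rewrite inE => /andP[/PI].
have vD' : (#|D :\ x| < v)%N by rewrite -ltnS -cD.
have := IH _ _ _ vD' PI' closed' dis'.
set S' := [set _ in Psi' | _]; set S := [set _ in Psi | _].
have -> : S' = S.
  apply/setP => phi; rewrite !inE -andbA; congr (_ && _).
  apply/andP/forall_inP => [[px /forall_inP h] y yD|h].
    by case: (eqVneq y x) => [->//|yx]; apply: h; rewrite !inE yx.
  by split; [exact: h | apply/forall_inP => y; rewrite !inE => /andP[_]; exact: h].
move=> IHx; rewrite cD cA ffactSS mulnCA mulnC.
apply: leq_trans (card_fix_one PI (g x) closed xA).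
by rewrite cA leq_mul2r /=; apply: IHx.
Qed.

Hypotheses (cardB : forall z, #|B z| = k) (B_refl : forall z, z \in B z).
Hypothesis ends_free : forall z z', z \in E -> z' \in E -> z != z' -> z \notin B z'.
Hypothesis cardZV : #|Z| = #|V|.

Lemma placements_closed J : swap_closed (placements J) (covered J).
Proof.
move=> phi x y; rewrite !inE => /andP[/injectiveP pI /forall_inP pJ] xU yU.
apply/andP; split; first by apply/injectiveP; apply: swap_inj.
apply/forall_inP => z zJ; rewrite swap_imset ?pJ //.
  by apply: contra xU => xz; apply/bigcupP; exists z.
by apply: contra yU => yz; apply/bigcupP; exists z.
Qed.

Lemma placements_inj J phi : phi \in placements J -> injective phi.
Proof. by rewrite inE => /andP[/injectiveP]. Qed.

Lemma swap_placement J z w phi :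
  J \subset E -> z \in E :\: J -> phi \in placements J -> w \notin covered J ->
  phi w |: phi @: (B z :\ z) \in edges H ->
  swap phi z w \in placements (z |: J).
Proof.
move=> JE; rewrite inE => /andP[zJ zE] pJ wU eH.
have zU : z \notin covered J.
  apply/bigcupP => -[z' z'J]; apply/negP/ends_free => //; first exact: (subsetP JE).
  by apply: contraNneq zJ => ->.
have := placements_closed pJ zU wU; rewrite !inE => /andP[-> /forall_inP sJ] /=.
apply/forall_inP => z'; rewrite !inE => /predU1P[->|]; last exact: sJ.
suff -> : swap phi z w @: B z = phi w |: phi @: (B z :\ z) by [].
(* Otherwise [phi w] would already lie in the image of the rest of the block, and the edge would
   have only [k.-1] vertices. *)
have wS : w \notin B z :\ z.
  apply/negP => wB; have := forall_inP (edges_uniform H) _ eH.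
  have -> : phi w |: phi @: (B z :\ z) = phi @: (B z :\ z).
    by apply/setUidPr; rewrite sub1set imset_f.
  rewrite (card_imset _ (placements_inj pJ)) => /eqP.
  by have := cardB z; rewrite (cardsD1 z) B_refl => <-; lia.
rewrite -{1}(setD1K (B_refl z)) imsetU1 ffunE tpermL swap_imset //.
by rewrite !inE eqxx.
Qed.

Lemma codegree_le_completions phi (S : {set V}) : (0 < k)%N -> injective phi -> #|S| = k.-1 ->
  (codegree H S <= #|[set w | phi w |: S \in edges H]|)%N.
Proof.
move=> k0 pI cS; set N := [set w | _].
apply: leq_trans (leq_imset_card (fun w => phi w |: S) N).
apply: subset_leq_card; apply/subsetP => e; rewrite inE => /andP[eH Se].
have ce : #|e| = k by apply/eqP; apply: (forall_inP (edges_uniform H)).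
have : (#|e :\: S| == 1)%N by rewrite cardsD (setIidPr Se) ce cS; lia.
move=> /cards1P[y ey].
have [psi _ psiK] := inj_card_bij pI (eq_leq (esym cardZV)).
have ee : e = phi (psi y) |: S.
  rewrite psiK -ey; apply/setP => x; rewrite !inE.
  by case: (boolP (x \in S)) => [/(subsetP Se)|]; rewrite ?orbF.
by apply/imsetP; exists (psi y); rewrite // inE -ee.
Qed.

(** Double counting of pairs [(phi, w)] such that moving [phi w] to position [z] turns the block of
    [z] into an edge of [H]. The codegree gives at least [m] choices of [w] outside the placed
    blocks, and the pair is recovered from the new placement together with [w]. *)
Lemma card_placements_step J z m : (0 < k)%N ->
  J \subset E -> z \in E :\: J ->
  (forall S : {set V}, #|S| = k.-1 -> (m + #|covered J| <= codegree H S)%N) ->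
  (m * #|placements J| <= #|Z| * #|placements (z |: J)|)%N.
Proof.
move=> k0 JE zJ deg.
pose good phi := [set w | phi w |: phi @: (B z :\ z) \in edges H] :\: covered J.
have good_ge phi : phi \in placements J -> (m <= #|good phi|)%N.
  move=> pJ; have pI := placements_inj pJ.
  have cS : #|phi @: (B z :\ z)| = k.-1.
    by rewrite card_imset //; have := cardB z; rewrite (cardsD1 z) B_refl => <-.
  have := subset_leq_card (subsetIr [set w | phi w |: phi @: (B z :\ z) \in edges H]
    (covered J)).
  have := leq_trans (deg _ cS) (codegree_le_completions k0 pI cS).
  by rewrite cardsD; lia.
pose Q := [set u : {ffun Z -> V} * Z | (u.1 \in placements J) && (u.2 \in good u.1)].
have QE : #|Q| = (\sum_(phi in placements J) #|good phi|)%N.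
  rewrite -sum1_card (eq_bigl (fun u => (u.1 \in placements J) && (u.2 \in good u.1))).
    rewrite -(pair_big_dep (mem (placements J)) (fun phi w => w \in good phi) (fun _ _ => 1%N)).
    by apply: eq_bigr => phi _; rewrite /= sum1_card.
  by move=> u; rewrite inE.
have : (m * #|placements J| <= #|Q|)%N.
  by rewrite QE mulnC -sum_nat_const; apply: leq_sum => phi; apply: good_ge.
move/leq_trans; apply; rewrite mulnC -[#|Z|]cardsT -cardsX.
rewrite -[leqLHS](@card_in_imset _ _ (fun u => (swap u.1 z u.2, u.2))).
  apply: subset_leq_card; apply/subsetP => _ /imsetP[[phi w] + ->].
  rewrite inE /= => /andP[pJ]; rewrite inE => /andP[wU]; rewrite inE => eH.
  by rewrite inE /= (swap_placement JE zJ pJ wU eH) inE.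
move=> [phi w] [psi w'] _ _ /= [E1 E2].
by move: E1; rewrite E2 => /(can_inj (swapK z w')) ->.
Qed.

(* Blocks that D touches are released from the constraint at the cost of a
   factor 1/c each; the values on D are then resampled uniformly among the
   positions outside the remaining blocks. *)
Lemma card_placements_fix (R : realFieldType) (c : R) D (g : Z -> V) :
  0 < c <= 1 ->
  (forall J z, J \subset E -> z \in E :\: J ->
     c * #|placements J|%:R <= #|placements (z |: J)|%:R) ->
  (forall x, (#|[set z | x \in B z]| <= k)%N) ->
  (#|Z| <= 2 * #|~: covered E|)%N ->
  #|[set phi in placements E | [forall x in D, phi x == g x]]|%:R <=
    #|placements E|%:R * (8 / c ^+ k / #|Z|%:R) ^+ #|D| :> R.
Proof.
move=> /andP[c0 c1] step degB large.
have c_ge0 := ltW c0.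
pose J0 := [set z in E | [disjoint B z & D]].
have J0E : J0 \subset E by apply/subsetP => z; rewrite inE => /andP[].
(* Adding the missing blocks one by one keeps at least a fraction [c] of the placements each
   time. *)
have grow J : J \subset E ->
    c ^+ #|E :\: J| * #|placements J|%:R <= #|placements E|%:R.
  have [v] := ubnP #|E :\: J|; elim: v J => // v IH J vJ JE.
  have [EJ|[z zJ]] := set_0Vmem (E :\: J).
    have -> : J = E by apply/eqP; rewrite eqEsubset JE -setD_eq0 EJ eqxx.
    by rewrite setDv cards0 expr0 mul1r.
  have cE : #|E :\: J| = #|E :\: (z |: J)|.+1.
    by rewrite (cardsD1 z) zJ add1n setDDl finset.setUC.
  rewrite cE exprSr -mulrA.
  apply: le_trans (IH (z |: J) _ _).
  - by rewrite ler_wpM2l ?exprn_ge0 // step.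
  - by rewrite -ltnS -cE.
  - by rewrite subUset sub1set JE andbT; move: zJ; rewrite inE => /andP[].
have cD : (#|E :\: J0| <= k * #|D|)%N.
  apply: leq_trans (card_bigcup_leq (F := fun x => [set z | x \in B z]) _) => //.
  apply: subset_leq_card; apply/subsetP => z; rewrite !inE => /andP[+ zE].
  rewrite zE /= => /pred0Pn[x /andP[xB xD]].
  by apply/bigcupP; exists x; rewrite // inE.
have disD : [disjoint D & covered J0].
  rewrite disjoint_subset; apply/subsetP => x xD; rewrite inE.
  apply/bigcupP => -[z]; rewrite inE => /andP[_ dz] xB.
  by rewrite (disjointFl dz xD) in xB.
pose S J := [set phi in placements J | [forall x in D, phi x == g x]].
have SS : (#|S E| <= #|S J0|)%N.
  apply: subset_leq_card; apply/subsetP => phi; rewrite !inE.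
  move=> /andP[/andP[-> /forall_inP pE] ->]; rewrite andbT /=.
  by apply/forall_inP => z zJ; apply: pE; apply: (subsetP J0E).
have := card_fix g (@placements_inj J0) (placements_closed (J := J0)) disD.
rewrite -/(S J0) => fixJ0.
set a := #|~: covered J0| in fixJ0.
have aZ : (#|Z| <= 2 * a)%N.
  apply: leq_trans large _; rewrite leq_mul2l /=; apply: subset_leq_card.
  rewrite setCS; apply/subsetP => x /bigcupP[z zJ xB]; apply/bigcupP; exists z => //.
  exact: (subsetP J0E).
have Da : (#|D| <= a)%N.
  by apply: subset_leq_card; move: disD; rewrite disjoints_subset.
set v := #|D| in cD fixJ0 Da *; set N := #|Z| in aZ *.
have [N0|N_gt0] := posnP N.
  have D0 : v = 0%N by apply/eqP; rewrite -leqn0 -N0 /v max_card.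
  rewrite D0 expr0 mulr1 ler_nat; apply: subset_leq_card.
  by apply/subsetP => phi; rewrite inE => /andP[].
(* The 8 is [2 * 4]: the 2 because [#|Z| <= 2 * a], the 4 from comparing powers with falling
   factorials. *)
have main : (#|S E| * N ^ v <= 8 ^ v * #|placements J0|)%N.
  apply: (@leq_trans (#|S J0| * (8 ^ v * a ^_ v))%N); last first.
    by rewrite mulnCA leq_mul2l fixJ0 orbT.
  apply: leq_mul => //; rewrite -[8%N]/(2 * 4)%N expnMn -mulnA.
  apply: (@leq_trans ((2 * a) ^ v)%N); first by case: (v) => // u; rewrite leq_exp2r.
  by rewrite expnMn leq_mul2l ffact_ge // orbT.
have pE : c ^+ (k * v) * #|placements J0|%:R <= #|placements E|%:R :> R.
  by apply: le_trans (grow _ J0E); rewrite ler_wpM2r // ler_wiXn2l // ltW.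
have cv0 : 0 < c ^+ (k * v) by rewrite exprn_gt0.
have Nv0 : 0 < N%:R ^+ v :> R by rewrite exprn_gt0 // ltr0n.
rewrite !exprMn !exprVn -exprM !mulrA ler_pdivlMr // ler_pdivlMr //.
apply: (@le_trans _ _ (c ^+ (k * v) * (8 ^ v * #|placements J0|)%:R)).
  by rewrite mulrC ler_wpM2l ?(ltW cv0) // -natrX -natrM ler_nat.
by rewrite natrM mulrCA [leRHS]mulrC natrX ler_wpM2l // exprn_ge0.
Qed.

End Placements.

(** * Overlap of two placements *)

Section PairOverlap.
Variables (n k l M : nat) (V : finType).
Local Notation Z := 'I_n.+2.
Variables (Phi : {set {ffun Z -> V}}) (phi0 : {ffun Z -> V}).
Hypotheses (Phi_inj : forall phi, phi \in Phi -> injective phi).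
Hypotheses (phi0_inj : injective phi0) (k3 : (3 <= k)%N).
Local Notation F := (free_edges n k l M).
Implicit Types (phi : {ffun Z -> V}) (u v : Z * Z) (P C : {set Z * Z}).

Definition image_edges phi : {set {set V}} := [set phi @: f | f : {set Z} in F].

Definition near_pair : rel (Z * Z) :=
  [rel u v | near_arc l u.1 v.1 && near_arc l u.2 v.2].

Definition common_edges phi := [set f in F | phi @: f \in image_edges phi0].

Definition agreement phi : {set Z * Z} :=
  [set u | (phi u.1 == phi0 u.2) && (u.1 \in cover (common_edges phi))].

Lemma near_pair_sym : symmetric near_pair.
Proof.
move=> u v; rewrite /near_pair /=.
by rewrite ![near_arc _ v.1 _]near_arc_sym ![near_arc _ v.2 _]near_arc_sym.
Qed.

Lemma near_pair_refl : reflexive near_pair.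
Proof. by move=> u; rewrite /near_pair /= !near_arc_refl. Qed.

Lemma card_near_pair u :
  (#|[set v | near_pair u v]| <= (l.+1 * l.+1) * (l.+1 * l.+1))%N.
Proof.
apply: leq_trans (leq_mul (card_near_arc l u.1) (card_near_arc l u.2)).
rewrite -cardsX; apply: subset_leq_card; apply/subsetP => v.
by rewrite !inE.
Qed.

Lemma card_image_edges phi : injective phi -> #|image_edges phi| = #|F|.
Proof. by move=> pI; rewrite card_imset //; apply: imset_inj. Qed.

Lemma card_common_edges phi : injective phi ->
  #|image_edges phi :&: image_edges phi0| = #|common_edges phi|.
Proof.
move=> pI; rewrite -[RHS](card_imset _ (imset_inj pI)); congr #|pred_of_set _|.
apply/setP => e; rewrite inE; apply/andP/imsetP => [[/imsetP[f fF ->] h]|[f + ->]].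
  by exists f; rewrite // inE fF.
by rewrite inE => /andP[fF h]; split=> //; apply: imset_f.
Qed.

Lemma fst_inj_agreement phi : {in agreement phi &, injective fst}.
Proof.
move=> [x y] [x' y']; rewrite !inE /= => /andP[/eqP E _] /andP[/eqP E' _] xx.
by move: E'; rewrite -xx E => /phi0_inj ->.
Qed.

(** The edge and its counterpart under [phi0] each lie in a single arc, so the pairs that match
    their vertices are pairwise near. *)
Lemma common_edge_sub_component phi u f : injective phi ->
  u \in agreement phi -> f \in common_edges phi -> u.1 \in f ->
  f \subset fst @: component near_pair (agreement phi) u.
Proof.
move=> pI uP fc uf; apply/subsetP => y yf.
have arcE g : g \in F -> exists i, g \subset arc l i.
  by rewrite inE => /andP[_]; rewrite inE => /andP[_ /existsP].
move: (fc); rewrite inE => /andP[fF /imsetP[f' f'F Ef]].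
have /imsetP[y' y'f Ey] : phi y \in phi0 @: f' by rewrite -Ef imset_f.
have vP : (y, y') \in agreement phi.
  by rewrite inE /= Ey eqxx; apply/bigcupP; exists f.
apply/imsetP; exists (y, y') => //; rewrite inE vP; apply: connect1.
apply/and3P; split=> //; apply/andP; split=> /=.
  have [i /subsetP fi] := arcE _ fF; apply/existsP; exists i.
  by rewrite !fi.
have [i /subsetP fi] := arcE _ f'F; apply/existsP; exists i.
rewrite !fi //; move: uP; rewrite inE => /andP[/eqP Eu _].
have : phi0 u.2 \in phi0 @: f' by rewrite -Eu -Ef imset_f.
by rewrite mem_imset.
Qed.

(** A component contains a whole common edge, hence at least [k >= 3] positions. This is what allows
    the sparse edge bound to be applied to every component. *)
Lemma card_component_agreement phi C : injective phi ->
  C \in components near_pair (agreement phi) -> (3 <= #|fst @: C|)%N.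
Proof.
move=> pI /imsetP[u uP ->].
move: (uP); rewrite inE => /andP[_ /bigcupP[f fc uf]].
apply: leq_trans (subset_leq_card (common_edge_sub_component pI uP fc uf)).
by move: fc; rewrite !inE => /andP[/andP[_ /andP[/eqP -> _]] _].
Qed.

Lemma card_common_edges_le phi : injective phi ->
  (#|common_edges phi| <=
     \sum_(C in components near_pair (agreement phi)) #|edges_in k l M (fst @: C)|)%N.
Proof.
move=> pI.
apply: (@leq_trans #|\bigcup_(C in components near_pair (agreement phi))
                       edges_in k l M (fst @: C)|).
  apply: subset_leq_card; apply/subsetP => f fc.
  have /andP[fF /imsetP[f' f'F Ef]] : (f \in F) && (phi @: f \in image_edges phi0).
    by move: fc; rewrite inE.
  have [x xf] : exists x, x \in f.
    apply/set0Pn; rewrite -card_gt0.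
    by move: fF; rewrite !inE => /andP[_ /andP[/eqP -> _]]; lia.
  have /imsetP[y _ Ey] : phi x \in phi0 @: f' by rewrite -Ef imset_f.
  have uP : (x, y) \in agreement phi.
    by rewrite inE /= Ey eqxx; apply/bigcupP; exists f.
  apply/bigcupP; exists (component near_pair (agreement phi) (x, y)).
    exact: imset_f.
  by rewrite inE fF; exact: common_edge_sub_component pI uP fc xf.
elim/big_rec2: _ => [|C m D _ IH]; first by rewrite cards0.
by rewrite (leq_trans (leq_card_setU _ _)) // leq_add2l.
Qed.

(** Group the [phi] by their agreement set [P]. The factor [b ^+ #|P|] bounds how often [P] occurs,
    the weight of the common edges splits over the components of [P], and the sum over [P] becomes a
    product over connected sets. *)
Lemma sum_overlap_le (R : realFieldType) (q a b lam : R) :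
  1 <= q -> 0 <= a -> 0 <= b -> 0 <= lam ->
  (forall X : {set Z}, (3 <= #|X|)%N -> q ^+ #|edges_in k l M X| <= a * lam ^+ #|X|) ->
  (forall (D : {set Z}) (g : Z -> V),
     #|[set phi in Phi | [forall x in D, phi x == g x]]|%:R <= #|Phi|%:R * b ^+ #|D|) ->
  \sum_(phi in Phi) q ^+ #|image_edges phi :&: image_edges phi0|
    <= #|Phi|%:R * \prod_(C : {set Z * Z} | connected_set near_pair C)
                      (1 + a * (b * lam) ^+ #|C|).
Proof.
move=> q1 a0 b0 lam0 weight spread.
have q0 : 0 <= q by apply: le_trans q1.
pose bound P := \prod_(C in components near_pair P) (a * lam ^+ #|C|).
have bound0 P : 0 <= bound P.
  by apply: prodr_ge0 => C _; rewrite mulr_ge0 // exprn_ge0.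
have le_bound phi : phi \in Phi ->
    q ^+ #|image_edges phi :&: image_edges phi0| <= bound (agreement phi).
  move=> pP; have pI := Phi_inj pP.
  rewrite card_common_edges // (le_trans (ler_weXn2l q1 (card_common_edges_le pI))) //.
  rewrite expr_sum; apply: ler_prod => C CP; rewrite exprn_ge0 //=.
  have CA : C \subset agreement phi.
    by case/imsetP: CP => u _ ->; apply/subsetP => v; rewrite inE => /andP[].
  rewrite -(@card_in_imset _ _ fst C); first exact: weight (card_component_agreement pI CP).
  by move=> u v uC vC; apply: (@fst_inj_agreement phi); apply: (subsetP CA).
rewrite (partition_big agreement predT) //=.
apply: (@le_trans _ _ (\sum_(P : {set Z * Z}) #|Phi|%:R * b ^+ #|P| * bound P)).
  apply: ler_sum => P _.
  (* If some [psi] has agreement [P], every other such [phi] equals [psi] on the first coordinates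
     of [P], and these are [#|P|] distinct positions. *)
  have [|[psi]] := set_0Vmem [set phi in Phi | agreement phi == P].
    move=> E0; rewrite big1 ?mulr_ge0 ?exprn_ge0 //.
    by move=> phi h; have := in_set0 phi; rewrite -E0 inE h.
  rewrite inE => /andP[psiP /eqP EP].
  apply: (@le_trans _ _ (#|[set phi in Phi | agreement phi == P]|%:R * bound P)).
    rewrite mulr_natl -sumr_const; under [leRHS]eq_bigl => phi do rewrite inE.
    by apply: ler_sum => phi /andP[pP /eqP <-]; apply: le_bound.
  rewrite ler_wpM2r //.
  have fI : {in P &, injective fst} by rewrite -EP; apply: fst_inj_agreement.
  rewrite -(card_in_imset fI); apply: le_trans (spread (fst @: P) psi).
  rewrite ler_nat; apply: subset_leq_card; apply/subsetP => phi.
  rewrite !inE => /andP[-> /eqP Ep] /=; apply/forall_inP => _ /imsetP[u uP ->].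
  have := uP; rewrite -{1}Ep inE => /andP[/eqP -> _].
  by move: uP; rewrite -EP inE => /andP[/eqP -> _].
have -> : \sum_(P : {set Z * Z}) #|Phi|%:R * b ^+ #|P| * bound P =
   #|Phi|%:R * \sum_P \prod_(C in components near_pair P) (a * (b * lam) ^+ #|C|).
  rewrite mulr_sumr; apply: eq_bigr => P _; rewrite -mulrA; congr (_ * _).
  rewrite {1}(card_partition (components_partition near_pair_sym P)).
  rewrite -prodrXr /bound -big_split /=; apply: eq_bigr => C _.
  by rewrite exprMn mulrCA.
rewrite ler_wpM2l ?ler0n //.
apply: (sum_prod_components near_pair_sym) => C.
by rewrite mulr_ge0 // exprn_ge0 // mulr_ge0.
Qed.

End PairOverlap.

(** * Second moment *)

From mathcomp Require Import reals sequences exp.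

Section SecondMoment.
Variables (R : realType) (k : nat) (V : finType) (p : R).
Implicit Types (S : {set {set V}}) (G : kgraph k V).

Lemma random_kgraph_prob_contains S : (forall e, e \in S -> #|e| = k) ->
  random_kgraph_prob p (fun G => S \subset edges G) = p ^+ #|S|.
Proof.
move=> Sk.
pose a (e : {set V}) : R := if #|e| == k then p else 0.
(* In the expansion, [a] weighs presence and [b] absence of a set: [b] vanishes on [S], whose edges
   must be present, and [a] vanishes on sets of the wrong size. *)
pose b e : R := if e \in S then 0 else if #|e| == k then 1 - p else 1.
have -> : p ^+ #|S| = \prod_(e : {set V}) (a e + b e).
  rewrite (bigID (mem S)) /= [X in _ = _ * X]big1 ?mulr1.
    rewrite -prodr_const; apply: eq_bigr => e eS.
    by rewrite /a /b eS (Sk e eS) eqxx addr0.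
  move=> e eS; rewrite /a /b (negbTE eS).
  by case: ifP => _; rewrite ?add0r // addrC subrK.
rewrite bigA_distr /= (bigID (fun J : {set {set V}} =>
  [forall e in J, #|e| == k] && (S \subset J))) /= [X in _ = _ + X]big1 ?addr0; last first.
  move=> J; rewrite negb_and => /orP[/forall_inPn[e eJ ek]|/subsetPn[e eS eJ]].
    by rewrite (bigD1 e) //= eJ /a (negbTE ek) mul0r.
  by rewrite (bigD1 e) //= (negbTE eJ) /b eS mul0r.
rewrite /random_kgraph_prob (reindex_omap (@edges k V) insub) /=; last first.
  by move=> J /andP[JU _]; rewrite insubT.
apply: eq_big => [G|G SG].
  by rewrite (edges_uniform G) (valK G) eqxx andbT.
rewrite /random_kgraph_mass big_mkcond /=; apply: eq_bigr => e _.
rewrite /a /b; case: ifPn => ek; case: ifPn => eG //.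
- by case: ifP => // /(subsetP SG); rewrite (negbTE eG).
- by have := forall_inP (edges_uniform G) e eG; rewrite (negbTE ek).
- by case: ifP => // /Sk; move/eqP: ek.
Qed.

Hypothesis p01 : 0 < p <= 1.

Let mass_ge0 G : 0 <= random_kgraph_mass p G.
Proof. by apply: random_kgraph_mass_ge0; case/andP: p01 => /ltW -> ->. Qed.

Lemma random_kgraph_prob_le1 (A : pred (kgraph k V)) : random_kgraph_prob p A <= 1.
Proof.
rewrite -(random_kgraph_prob_total k V p) /random_kgraph_prob.
by rewrite [leRHS](bigID A) /= lerDl sumr_ge0.
Qed.

Lemma random_kgraph_prob_mono (A B : pred (kgraph k V)) :
  (forall G, A G -> B G) -> random_kgraph_prob p A <= random_kgraph_prob p B.
Proof.
move=> AB; rewrite /random_kgraph_prob [leLHS]big_mkcond [leRHS]big_mkcond /=.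
apply: ler_sum => G _; case: ifP => [/AB ->//|_]; by case: ifP.
Qed.

(** Chebyshev's inequality for the number [Y] of indices with [S i] inside [G]. As [S i :|: S j] has
    [2 * m - #|S i :&: S j|] edges, the double sum is the second moment of [Y] divided by
    [p ^+ (2 * m)]. *)
Lemma second_moment (I : finType) (Phi : {set I}) (S : I -> {set {set V}})
    (m : nat) (del : R) :
  Phi != set0 ->
  (forall i, i \in Phi -> #|S i| = m) ->
  (forall i, i \in Phi -> forall e, e \in S i -> #|e| = k) ->
  \sum_(i in Phi) \sum_(j in Phi) p^-1 ^+ #|S i :&: S j|
    <= #|Phi|%:R ^+ 2 * (1 + del) ->
  1 - del <= random_kgraph_prob p
    (fun G : kgraph k V => [exists i in Phi, S i \subset edges G]).
Proof.
move=> Phi0 Sm Sk le2.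
have /andP[p0 p1] := p01.
pose mu : R := #|Phi|%:R * p ^+ m.
have mu0 : 0 < mu by rewrite mulr_gt0 ?exprn_gt0 // ltr0n card_gt0.
pose mass := random_kgraph_mass (k := k) (V := V) p.
pose ind i G : R := (S i \subset edges G)%:R.
pose Y G : R := \sum_(i in Phi) ind i G.
have ind_sum (T : {set {set V}}) : (forall e, e \in T -> #|e| = k) ->
    \sum_G mass G * (T \subset edges G)%:R = p ^+ #|T|.
  move=> Tk; rewrite -(random_kgraph_prob_contains Tk) /random_kgraph_prob.
  rewrite [RHS]big_mkcond /=; apply: eq_bigr => G _.
  by case: (T \subset _); rewrite ?mulr1 ?mulr0.
have total : \sum_G mass G = 1 by exact: (random_kgraph_prob_total k V p).
have EY : \sum_G mass G * Y G = mu.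
  under eq_bigr => G _ do rewrite mulr_sumr.
  rewrite exchange_big /=; under eq_bigr => i iP do
    rewrite (ind_sum _ (Sk i iP)) (Sm i iP).
  by rewrite sumr_const -mulr_natl.
have EY2 : \sum_G mass G * Y G ^+ 2 =
    (p ^+ m) ^+ 2 * \sum_(i in Phi) \sum_(j in Phi) p^-1 ^+ #|S i :&: S j|.
  have -> : \sum_G mass G * Y G ^+ 2 = \sum_(i in Phi) \sum_(j in Phi)
      \sum_G mass G * (S i :|: S j \subset edges G)%:R.
    under [RHS]eq_bigr => i _ do rewrite exchange_big /=.
    rewrite [RHS]exchange_big /=; apply: eq_bigr => G _.
    rewrite expr2 /Y mulr_suml mulr_sumr; apply: eq_bigr => i _.
    rewrite mulr_sumr mulr_sumr; apply: eq_bigr => j _.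
    by rewrite /ind subUset -natrM mulnb.
  rewrite mulr_sumr; apply: eq_bigr => i iP; rewrite mulr_sumr.
  apply: eq_bigr => j jP; rewrite ind_sum; last first.
    by move=> e; rewrite inE => /orP[/(Sk i iP)|/(Sk j jP)].
  have := cardsUI (S i) (S j); rewrite (Sm i iP) (Sm j jP) => cUI.
  apply: (mulIf (x := p ^+ #|S i :&: S j|)); first by rewrite expf_neq0 // gt_eqF.
  rewrite -exprD cUI -mulrA exprVn mulVf ?expf_neq0 ?gt_eqF // mulr1.
  by rewrite -exprM mulnC mul2n addnn.
have Var : \sum_G mass G * (Y G - mu) ^+ 2 <= mu ^+ 2 * del.
  have -> : \sum_G mass G * (Y G - mu) ^+ 2 =
      \sum_G mass G * Y G ^+ 2 - mu ^+ 2.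
    transitivity (\sum_G (mass G * Y G ^+ 2 - (2 * mu) * (mass G * Y G) + mu ^+ 2 * mass G)).
      by apply: eq_bigr => G _; ring.
    rewrite big_split /= sumrB -!mulr_sumr EY total; ring.
  rewrite EY2 lerBlDr /mu exprMn.
  have pm : 0 <= (p ^+ m) ^+ 2 by rewrite exprn_ge0 // exprn_ge0 // ltW.
  have := ler_wpM2l pm le2.
  by move/le_trans; apply; rewrite le_eqVlt; apply/orP; left; apply/eqP; ring.
set A := (X in random_kgraph_prob _ X).
have compl : random_kgraph_prob p A = 1 - \sum_(G | ~~ A G) mass G.
  by rewrite -total [X in _ = X - _](bigID A) /= addrK.
rewrite compl lerD2l lerN2 -(ler_pM2l (exprn_gt0 2 mu0)).
apply: le_trans Var; rewrite mulr_sumr [leRHS](bigID (fun G => ~~ A G)) /=.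
apply: ler_wpDr.
  by apply: sumr_ge0 => G _; rewrite mulr_ge0 ?sqr_ge0 // mass_ge0.
(* Outside the event [Y] is zero, so each such graph contributes [mu ^+ 2] times its mass to the
   variance. *)
apply: ler_sum => G; rewrite /A negb_exists_in => /forall_inP noS.
rewrite /Y big1 ?sub0r ?sqrrN 1?mulrC // => i iP.
by rewrite /ind (negbTE (noS i iP)).
Qed.

End SecondMoment.

Lemma prod1D_le_expR (R : realType) (I : finType) (P : pred I) (w : I -> R) :
  (forall i, 0 <= w i) -> \prod_(i | P i) (1 + w i) <= expR (\sum_(i | P i) w i).
Proof.
move=> w0; rewrite expR_sum; apply: ler_prod => i _.
by rewrite expR_ge1Dx addr_ge0.
Qed.

(** * From placements to powers of tight Hamilton cycles *)

Section Hamilton.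
Variables (n k r M : nat) (V : finType).
Local Notation Z := 'I_n.+2.
Hypothesis cardV : #|V| = n.+2.

(** Passes from rotations of a list to addition modulo [n.+2]. *)
Lemma window_codom (phi : {ffun Z -> V}) (i : nat) (m : nat) :
  (i < n.+2)%N ->
  window [seq phi z | z <- enum Z] m.+1 i \subset phi @: arc m (i%:R : Z).
Proof.
move=> iN; apply/subsetP => x; rewrite inE -map_rot -map_take => /mapP[z zt ->].
apply: imset_f.
set s := rot i (enum Z) in zt; pose j := index z (take m.+1 s).
have szs : size s = n.+2 by rewrite size_rot size_enum_ord.
have jt : (j < minn m.+1 n.+2)%N by rewrite -[n.+2]szs -size_take_min index_mem.
have jm : (j < m.+1)%N by apply: leq_trans jt (geq_minl _ _).
have jn : (j < n.+2)%N by apply: leq_trans jt (geq_minr _ _).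
have zj : z = nth ord0 s j by rewrite -(nth_take _ jm) nth_index.
apply/imsetP; exists (Ordinal jm) => //=.
apply: ord_inj; rewrite -natrD val_natr_ord zj /s /rot nth_cat size_drop size_enum_ord.
case: ltnP => h.
  by rewrite nth_drop nth_enum_ord ?modn_small //; lia.
rewrite nth_take ?nth_enum_ord; [|lia|lia].
have -> : (i + j = (j - (n.+2 - i)) + n.+2)%N by lia.
by rewrite modnDr modn_small //; lia.
Qed.

(** An edge of the cycle power, pulled back along [phi], is either a block, mapped into [H], or a
    free edge, mapped into [G]. *)
Lemma contains_of_placement (H G : kgraph k V) (phi : {ffun Z -> V}) :
  (0 < k + r - 1)%N ->
  phi \in placements H (@block n k) (block_ends n k M) ->
  image_edges k (k + r - 2) M phi \subset edges G ->
  contains_tight_hamilton_cycle_power r (kunion H G).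
Proof.
move=> kr pP imG; have pI := placements_inj pP.
pose s := [seq phi z | z <- enum Z].
have ss : size s == #|V| by rewrite size_map size_enum_ord cardV.
apply/existsP; exists (tight_cycle_power k r s); apply/andP; split.
  apply/existsP; exists (Tuple ss); rewrite eqxx andbT.
  by rewrite map_inj_uniq // enum_uniq.
apply/subsetP => e; rewrite inE => /andP[ek /existsP[i ew]].
have iN : (i < n.+2)%N by apply: leq_trans (ltn_ord i) _; rewrite (eqP ss) cardV.
have earc : e \subset phi @: arc (k + r - 2) (i%:R : Z).
  apply: subset_trans ew _.
  have -> : (k + r - 1 = (k + r - 2).+1)%N by lia.
  exact: window_codom.
pose f := phi @^-1: e.
have ef : e = phi @: f.
  apply/setP => y; apply/idP/imsetP => [ye|[z + ->]]; last by rewrite inE.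
  have /imsetP[z _ yz] := subsetP earc _ ye.
  by exists z; rewrite // inE -yz.
have fc : f \in cyclic_edges n k (k + r - 2).
  rewrite inE -(card_imset _ pI) -ef ek; apply/existsP; exists i%:R.
  apply/subsetP => z; rewrite inE => /(subsetP earc) /imsetP[z' z'a /pI ->] //.
rewrite inE; case: (boolP (f \in [set block k z | z in block_ends n k M])) => fb.
  case/imsetP: fb => z zE fz; move: pP; rewrite inE => /andP[_ /forall_inP h].
  by rewrite ef fz h.
by apply/orP; right; apply: (subsetP imG); rewrite ef imset_f // inE fb.
Qed.
End Hamilton.

(* With eps = 1 / (16 M d ^ 3), this is the inequality
   (1 / d + eps) e <= (1 - d eps) v - 2 cleared of denominators. *)
Lemma exponent_bound (M d e v : nat) : (0 < d)%N ->
  (2 * M * e + v <= 2 * M * d * v)%N ->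
  ((v <= 8 * M * d)%N -> (e + 2 * d + 1 <= d * v)%N) ->
  ((16 * M * d ^ 2 + 1) * e + d * v + 32 * M * d ^ 3 <= 16 * M * d ^ 3 * v)%N.
Proof.
(* Up to the threshold, the extra 1 in [sparse], scaled by [16 * M * d ^ 2], absorbs [2 * d * v].
   Beyond it, the gain [8 * d ^ 2 * v] from [dense] absorbs the constant [32 * M * d ^ 3] and the
   terms [e] and [d * v]. *)
move=> d0 dense sparse; case: (leqP v (8 * M * d)) => vL.
  have h1 : ((16 * M * d ^ 2 + 1) * (e + 2 * d + 1) <= (16 * M * d ^ 2 + 1) * (d * v))%N.
    by rewrite leq_mul2l (sparse vL) orbT.
  have h2 : (2 * d * v <= 2 * d * (8 * M * d))%N by rewrite leq_mul2l vL orbT.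
  move: h1 h2; rewrite !expnS expn0 !muln1; clear; nia.
have h1 : (8 * d ^ 2 * (2 * M * e + v) <= 8 * d ^ 2 * (2 * M * d * v))%N.
  by rewrite leq_mul2l dense orbT.
have h2 : (e <= d * v)%N.
  have [M0|M0] := posnP M; first by subst M; lia.
  by rewrite -(leq_pmul2l (m := 2 * M)) ?muln_gt0 // mulnA; lia.
have h3 : (4 * d ^ 2 * (8 * M * d) <= 4 * d ^ 2 * v)%N by rewrite leq_mul2l (ltnW vL) orbT.
have h4 : (d * v <= d ^ 2 * v)%N by rewrite leq_mul2r expnS expn1 leq_pmulr ?orbT.
move: h1 h2 h3 h4; rewrite !expnS expn0 !muln1.
move: (d * v)%N => x; clear; nia.
Qed.

(** The factor [N ^- 2] will cancel the number of pairs of positions at which a component can start;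
    the exponent below 1 will leave a negative power of [N] per pair, after a factor of order
    [1 / N] for each prescribed value. *)
Lemma weight_bound (R : realType) (N q : R) (M d e v : nat) :
  (0 < d)%N -> (0 < M)%N -> 1 <= N -> 0 <= q ->
  q <= N `^ (d%:R^-1 + (16 * M * d ^ 3)%:R^-1) ->
  (2 * M * e + v <= 2 * M * d * v)%N ->
  ((v <= 8 * M * d)%N -> (e + 2 * d + 1 <= d * v)%N) ->
  q ^+ e <= N ^- 2 * (N `^ (1 - (16 * M * d ^ 2)%:R^-1)) ^+ v.
Proof.
move=> d0 M0 N1 q0 qle dense sparse.
have N0 : 0 < N by apply: lt_le_trans N1.
have D0 : 0 < d%:R :> R by rewrite ltr0n.
have Mr0 : 0 < M%:R :> R by rewrite ltr0n.
apply: (@le_trans _ _ ((N `^ (d%:R^-1 + (16 * M * d ^ 3)%:R^-1)) ^+ e)).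
  by rewrite lerXn2r // nnegrE ?powR_ge0.
have -> : N ^- 2 = N `^ (- 2%:R) by rewrite powRN powR_mulrn // ltW.
rewrite -!powR_mulrn ?powR_ge0 // -!powRrM -powRD; last by rewrite (gt_eqF N0) implybT.
rewrite ler_powR //.
have := exponent_bound d0 dense sparse; rewrite -(ler_nat R).
rewrite !(natrD, natrM, natrX) => h.
rewrite -subr_ge0.
have -> : - 2 + (1 - (16 * M%:R * d%:R ^+ 2)^-1) * v%:R -
    (d%:R^-1 + (16 * M%:R * d%:R ^+ 3)^-1) * e%:R =
  (16 * M%:R * d%:R ^+ 3 * v%:R - ((16 * M%:R * d%:R ^+ 2 + 1) * e%:R +
     d%:R * v%:R + 32 * M%:R * d%:R ^+ 3)) / (16 * M%:R * d%:R ^+ 3) :> R.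
  by field; rewrite !gt_eqF.
by rewrite divr_ge0 ?subr_ge0 // !mulr_ge0 ?exprn_ge0 // ltW.
Qed.

Lemma min_codegree_le (k : nat) (V : finType) (H : kgraph k V) (S : {set V}) :
  #|S| = k.-1 -> (min_codegree H <= codegree H S)%N.
Proof.
move=> cS; rewrite /min_codegree.
by apply: (@bigmin_le_cond _ nat _ #|V| S (fun S => #|S| == k.-1)); rewrite cS.
Qed.

(** * The probability bound for a fixed number of vertices *)

Section FixedSize.
Variables (R : realType) (k r M n : nat) (V : finType) (H : kgraph k V) (c p : R).
Local Notation N := n.+2.
Local Notation Z := 'I_n.+2.
Local Notation l := (k + r - 2)%N.
Local Notation d := 'C(l, k.-1).
Local Notation ends := (block_ends n k M).
Local Notation gam := ((16 * M * d ^ 2)%:R^-1 : R).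
Local Notation Del := ((l.+1 * l.+1) * (l.+1 * l.+1))%N.
Local Notation kap := (8 / c ^+ k * N%:R `^ (- gam)).

Implicit Types (J X : {set Z}) (z : Z).

Hypotheses (k3 : (3 <= k)%N) (r2 : (2 <= r)%N) (cardV : #|V| = N).
Hypotheses (M4 : (4 * k <= M)%N) (MN : (2 * M <= N)%N).
Hypothesis LN : (l * (8 * M * d) < N)%N.
Hypothesis c01 : 0 < c <= 1.
Hypothesis degH : c * N%:R + (k * (N %/ M).+1)%:R <= (min_codegree H)%:R.
Hypothesis p01 : 0 < p <= 1.
Hypothesis p_ge : p^-1 <= N%:R `^ (d%:R^-1 + (16 * M * d ^ 3)%:R^-1).
Hypothesis kap_le : kap * 2 ^+ Del <= 1.

Let kl : (k <= l)%N. Proof. by lia. Qed.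
Let kM : (k <= M)%N. Proof. by lia. Qed.

Lemma card_covered_ends J : J \subset ends ->
  (#|covered (@block n k) J| <= k * (N %/ M).+1)%N.
Proof.
move=> JE; apply: (@leq_trans (k * #|J|)%N).
  by apply: card_bigcup_leq => z _; rewrite (leq_trans (leq_imset_card _ _)) // card_ord.
rewrite leq_mul2l (leq_trans (subset_leq_card JE)) ?orbT //.
exact: card_block_ends k3 kM.
Qed.

Lemma ends_disjoint z z' :
  z \in ends -> z' \in ends -> z != z' -> z \notin block k z'.
Proof. exact: (@block_end_notin n k M k3 kM z z'). Qed.

Lemma block_card z : #|block k z| = k.
Proof. exact: card_block k3 kM MN z. Qed.

(** The term [k * (N %/ M).+1] in [degH] pays for the positions covered by blocks already placed; at
    least [c * N] completions remain. *)
Lemma placements_step J z : J \subset ends -> z \in ends :\: J ->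
  c * #|placements H (@block n k) J|%:R <= #|placements H (@block n k) (z |: J)|%:R.
Proof.
move=> JE zJ.
pose m := (min_codegree H - k * (N %/ M).+1)%N.
have cov_le : (k * (N %/ M).+1 <= min_codegree H)%N.
  rewrite -(ler_nat R); apply: le_trans degH; rewrite lerDr mulr_ge0 //.
  by case/andP: c01 => /ltW.
have mN : c * N%:R <= m%:R by rewrite natrB // lerBrDr.
have step : (m * #|placements H (@block n k) J| <=
    #|{: Z}| * #|placements H (@block n k) (z |: J)|)%N.
  apply: (card_placements_step (E := ends)) => //.
  - exact: block_card.
  - by move=> z'; apply: block_refl.
  - exact: ends_disjoint.
  - by rewrite card_ord cardV.
  - exact: ltn_trans k3.
  move=> S cS; apply: leq_trans (min_codegree_le H cS).
  by rewrite (leq_trans (leq_add (leqnn m) (card_covered_ends JE))) // subnK.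
have N0 : 0 < N%:R :> R by rewrite ltr0n.
rewrite -(ler_pM2l N0); move: step; rewrite card_ord -(ler_nat R) !natrM.
by apply: le_trans; rewrite mulrA ler_wpM2r // mulrC.
Qed.

Lemma card_placements_spread (D : {set Z}) (g : Z -> V) :
  #|[set phi in placements H (@block n k) ends | [forall x in D, phi x == g x]]|%:R <=
    #|placements H (@block n k) ends|%:R * (8 / c ^+ k / N%:R) ^+ #|D| :> R.
Proof.
have := card_placements_fix (H := H) (B := @block n k) (E := ends) D g c01.
rewrite card_ord; apply.
- by move=> J z; apply: placements_step.
- move=> x; pose shift (j : 'I_k) : Z := x + (j : nat)%:R.
  rewrite -[leqRHS]card_ord; apply: leq_trans (leq_imset_card shift _).
  apply: subset_leq_card; apply/subsetP => z; rewrite inE => /imsetP[j _ Ex].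
  by apply/imsetP; exists j; rewrite // /shift Ex subrK.
(* The blocks cover at most [k + N %/ 4] positions, and [8 * k <= 2 * M <= N], so at least half of
   the positions stay uncovered. *)
- have := cardsC (covered (@block n k) ends); rewrite card_ord.
  have := card_covered_ends (subxx ends).
  have : (k * (N %/ M).+1 <= k + N %/ 4)%N.
    rewrite mulnS leq_add2l; apply: leq_trans (leq_mul (leqnn k) (leq_div2l N _ M4)) _.
      by lia.
    have : (k * (N %/ (4 * k)) = k * ((N %/ 4) %/ k))%N by rewrite -divnMA.
    by move=> ->; rewrite mulnC leq_divM.
  by lia.
Qed.

(** Starting from an enumeration of [V], adding a block keeps a positive fraction [c] of a nonempty
    set. *)
Lemma placements_nonempty : placements H (@block n k) ends != set0.
Proof.
have /andP[c0 c1] := c01.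
have grow J : J \subset ends -> placements H (@block n k) J != set0.
  have [v] := ubnP #|J|; elim: v J => // v IH J vJ JE.
  have [->|[z zJ]] := set_0Vmem J.
    have [f fI] : exists f : {ffun Z -> V}, injective f.
      exists [ffun z => enum_val (cast_ord (esym cardV) z)] => x y.
      by rewrite !ffunE => /enum_val_inj/cast_ord_inj.
    apply/set0Pn; exists f; rewrite inE; apply/andP; split; first exact/injectiveP.
    by apply/forall_inP => z; rewrite inE.
  have zE : z \in ends :\: (J :\ z) by rewrite finset.in_setD (subsetP JE) // in_setD1 eqxx.
  have := placements_step (subset_trans (subD1set _ _) JE) zE; rewrite setD1K //.
  have := IH (J :\ z); rewrite (cardsD1 z) zJ in vJ.
  move=> /(_ vJ (subset_trans (subD1set _ _) JE)).
  rewrite -!card_gt0 -!(ltr_nat R) => h; apply: lt_le_trans.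
  by rewrite mulr_gt0.
exact: grow.
Qed.

(** [LN] makes every [X] of size at most [8 * M * d] sparse enough to have a last vertex, so both
    edge bounds are available. *)
Lemma edges_in_weight (X : {set Z}) : (3 <= #|X|)%N ->
  p^-1 ^+ #|edges_in k l M X| <= N%:R ^- 2 * (N%:R `^ (1 - gam)) ^+ #|X|.
Proof.
move=> X3; have p0 : 0 < p by case/andP: p01.
apply: weight_bound p_ge _ _.
- by rewrite bin_gt0; lia.
- by lia.
- by rewrite ler1n.
- by rewrite invr_ge0 ltW.
- exact: card_edges_in k3 kM MN kl X.
move=> XL; apply: (card_edges_in_small k3 kM MN kl X3).
by apply: leq_ltn_trans LN; rewrite leq_mul2l XL orbT.
Qed.

(** Each pair in a component contributes [kap], the product of the spread and the edge weight.
    Connected sets of pairs have total weight at most [N ^ 2 * kap * 2 ^+ Del], and the prefactor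
    [N ^- 2] of each component removes the [N ^ 2]. *)
Lemma overlap_bound (phi0 : {ffun Z -> V}) : injective phi0 ->
  \sum_(phi in placements H (@block n k) ends)
     p^-1 ^+ #|image_edges k l M phi :&: image_edges k l M phi0|
    <= #|placements H (@block n k) ends|%:R * expR (kap * 2 ^+ Del).
Proof.
move=> phi0I; have /andP[p0 p1] := p01; have /andP[c0 c1] := c01.
have N0 : 0 < N%:R :> R by rewrite ltr0n.
have b0 : 0 <= 8 / c ^+ k / N%:R :> R by rewrite !divr_ge0 ?exprn_ge0 // ltW.
have kap0 : 0 <= kap by rewrite mulr_ge0 ?powR_ge0 // divr_ge0 ?exprn_ge0 // ltW.
apply: le_trans (sum_overlap_le _ phi0I k3 _ _ b0 (powR_ge0 _ _) edges_in_weight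
  card_placements_spread) _.
- by move=> phi; apply: placements_inj.
- by rewrite invf_ge1.
- by rewrite invr_ge0 exprn_ge0 // ltW.
rewrite ler_wpM2l ?ler0n //.
have -> : 8 / c ^+ k / N%:R * N%:R `^ (1 - gam) = kap.
  rewrite powRD; last by rewrite (gt_eqF N0) implybT.
  by rewrite powRr1 ?(ltW N0) // mulrA divfK // gt_eqF.
apply: le_trans (prod1D_le_expR _ _) _.
  by move=> C; rewrite mulr_ge0 ?exprn_ge0 // invr_ge0 exprn_ge0 // ltW.
rewrite ler_expR -mulr_sumr.
have := sum_connected_weight (@near_pair_refl n l)
  (@card_near_pair n l) kap0 kap_le.
rewrite card_prod !card_ord => h.
rewrite mulrC ler_pdivrMr ?exprn_gt0 //.
by apply: le_trans h _; rewrite (natrM _ N N) mulrC expr2.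
Qed.

Lemma perturbed_prob_ge :
  2 - expR (kap * 2 ^+ Del) <= random_kgraph_prob p (fun G : kgraph k V =>
    contains_tight_hamilton_cycle_power r (kunion H G)).
Proof.
pose Phi := placements H (@block n k) ends.
have key : 1 - (expR (kap * 2 ^+ Del) - 1) <= random_kgraph_prob p
    (fun G : kgraph k V => [exists phi in Phi, image_edges k l M phi \subset edges G]).
  apply: (second_moment p01 (m := #|free_edges n k l M|)).
  - exact: placements_nonempty.
  - by move=> phi /placements_inj; apply: card_image_edges.
  - move=> phi /placements_inj pI e /imsetP[f + ->]; rewrite card_imset //.
    by rewrite !inE => /andP[_ /andP[/eqP]].
  rewrite addrCA subrr addr0 expr2 -mulrA mulr_natl -sumr_const.
  apply: ler_sum => phi /placements_inj pI.
  under eq_bigr => psi _ do rewrite setIC.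
  exact: overlap_bound.
have -> : 2 - expR (kap * 2 ^+ Del) = 1 - (expR (kap * 2 ^+ Del) - 1) by ring.
apply: le_trans key _; apply: (random_kgraph_prob_mono p01) => G /exists_inP[phi pP imG].
have kr0 : (0 < k + r - 1)%N by clear -k3; lia.
by apply: (contains_of_placement cardV kr0 pP imG).
Qed.

End FixedSize.

(* Choice of constants and passage to the limit *)
From mathcomp Require Import all_classical all_reals all_analysis.

Import numFieldNormedType.Exports.

Local Open Scope classical_set_scope.
Local Open Scope ring_scope.

Lemma natr_powRN_cvg0 (R : realType) (g : R) : 0 < g ->
  n%:R `^ (- g) @[n --> \oo] --> (0 : R).
Proof.
move=> g0; apply/cvgr0Pnorm_le => e e0.
near=> n.
have nge : e^-1 `^ g^-1 <= n%:R by near: n; exact: nbhs_infty_ger.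
rewrite ger0_norm ?powR_ge0 // powRN -[leRHS]invrK.
have ei0 : 0 < e^-1 by rewrite invr_gt0.
have le : e^-1 <= n%:R `^ g.
  have gn0 : g != 0 by rewrite gt_eqF.
  have -> : e^-1 = (e^-1 `^ g^-1) `^ g by rewrite -powRrM mulVf // powRr1 // ltW.
  by apply: ge0_ler_powR; rewrite ?nnegrE ?powR_ge0 // ltW.
by rewrite lef_pV2 // posrE //; apply: lt_le_trans le.
Unshelve. all: by end_near.
Qed.

Theorem theorem1p2 (R : realType) (k r : nat) (alpha : R) :
  (3 <= k)%N -> (2 <= r)%N -> 0 < alpha ->
  exists eps : R, 0 < eps /\
    forall (V : nat -> finType) (H : forall n, kgraph k (V n)) (p : nat -> R),
      (forall n, #|V n| = n) ->
      (forall n, 0 <= p n <= 1) ->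
      (\forall n \near \oo, alpha * n%:R <= (min_codegree (H n))%:R) ->
      (\forall n \near \oo,
         n%:R `^ (- ('C(k + r - 2, k - 1)%:R)^-1 - eps) <= p n) ->
      random_kgraph_prob (p n) (fun G : kgraph k (V n) =>
        contains_tight_hamilton_cycle_power r (kunion (H n) G))
      @[n --> \oo] --> (1 : R).
Proof.
move=> k3 r2 alpha0; rewrite subn1.
pose l := (k + r - 2)%N; pose d := 'C(l, k.-1).
have d0 : (0 < d)%N by rewrite bin_gt0 /l; lia.
pose t := Num.Def.archi_bound alpha^-1.
have t_gt : alpha^-1 < t%:R by apply: archi_boundP; rewrite invr_ge0 ltW.
(* As [t > 1 / alpha], the blocks have density at most [alpha / 4], up to rounding; [M], and with it
   the exponent gain, depends only on [k] and [alpha], not on [n]. *)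
pose M := (4 * k * t.+1)%N.
have k0 : (0 < k)%N by lia.
have M4 : (4 * k <= M)%N by rewrite leq_pmulr.
exists (16 * M * d ^ 3)%:R^-1; split.
  by rewrite invr_gt0 ltr0n !muln_gt0 !d0 k0.
move=> V H p cardV p01 degH p_ge.
(* A quarter of the codegree is left for choosing completions; the minimum with 1 ensures
   [c <= 1]. *)
pose c := Num.min (alpha / 4) 1.
have c01 : 0 < c <= 1 by rewrite /c lt_min ge_min lexx orbT ltr01 divr_gt0.
pose gam : R := (16 * M * d ^ 2)%:R^-1.
have gam0 : 0 < gam by rewrite invr_gt0 ltr0n !muln_gt0 !d0 k0.
pose Del := ((l.+1 * l.+1) * (l.+1 * l.+1))%N.
pose eta (n : nat) : R := 8 / c ^+ k * n%:R `^ (- gam) * 2 ^+ Del.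
have eta_cvg : eta n @[n --> \oo] --> (0 : R).
  have -> : (0 : R) = 8 / c ^+ k * 0 * 2 ^+ Del by rewrite mulr0 mul0r.
  apply: cvgM; last exact: cvg_cst.
  by apply: cvgM; [exact: cvg_cst | exact: natr_powRN_cvg0].
have low_cvg : 2 - expR (eta n) @[n --> \oo] --> (1 : R).
  have E : 2 - expR 0 = 1 :> R by rewrite expR0; ring.
  rewrite -[X in _ --> X]E; apply: cvgB; first exact: cvg_cst.
  exact: (cvg_comp eta expR eta_cvg (@continuous_expR R 0)).
have eta_le1 : \forall n \near \oo, eta n <= 1 by exact: cvgr_le eta_cvg _ _.
have bound n : (2 <= n)%N -> (2 * M <= n)%N -> (l * (8 * M * d) < n)%N -> eta n <= 1 ->
    0 < p n <= 1 -> (p n)^-1 <= n%:R `^ (d%:R^-1 + (16 * M * d ^ 3)%:R^-1) ->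
    c * n%:R + (k * (n %/ M).+1)%:R <= (min_codegree (H n))%:R ->
    2 - expR (eta n) <= random_kgraph_prob (p n) (fun G : kgraph k (V n) =>
      contains_tight_hamilton_cycle_power r (kunion (H n) G)).
  (* The positions form ['I_n.+2], so sizes 0 and 1 are split off; [2 <= n] excludes them. *)
  case: n => [|[|n]] // _ MN LN etan p01n pinv deg.
  exact: (perturbed_prob_ge k3 r2 (cardV _) M4 MN LN c01 deg p01n pinv etan).
apply: (@squeeze_cvgr _ _ _ R (fun n => 2 - expR (eta n)) (fun=> 1) _ _ 1 low_cvg);
  last exact: cvg_cst.
near=> n.
have n2 : (2 <= n)%N by near: n; exact: nbhs_infty_ge.
have MN : (2 * M <= n)%N by near: n; exact: nbhs_infty_ge.
have LN : (l * (8 * M * d) < n)%N by near: n; exact: nbhs_infty_ge.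
have kn : (2 * k * t <= n)%N by near: n; exact: nbhs_infty_ge.
have etan : eta n <= 1 by near: n.
have degn : alpha * n%:R <= (min_codegree (H n))%:R by near: n.
have pn : n%:R `^ (- (d%:R)^-1 - (16 * M * d ^ 3)%:R^-1) <= p n by near: n.
have n0 : 0 < n%:R :> R by rewrite ltr0n ltnW.
have p0 : 0 < p n by apply: lt_le_trans pn; rewrite powR_gt0.
have p01n : 0 < p n <= 1 by rewrite p0; case/andP: (p01 n).
apply/andP; split; last exact: random_kgraph_prob_le1.
have pinv : (p n)^-1 <= n%:R `^ (d%:R^-1 + (16 * M * d ^ 3)%:R^-1).
  rewrite -[leRHS]invrK -powRN opprD lef_pV2 // posrE // powR_gt0 //.
(* The budget [alpha * n] is split as one quarter for [c * n], one quarter for the full periods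
   [k * (n %/ M)], and one half for the single extra block of [k] positions. *)
have deg : c * n%:R + (k * (n %/ M).+1)%:R <= (min_codegree (H n))%:R.
  apply: le_trans degn.
  have at1 : 1 <= alpha * t%:R.
    by rewrite mulrC -ler_pdivrMr // div1r ltW.
  have h1 : c * n%:R <= alpha / 4 * n%:R by rewrite ler_pM2r // ge_min lexx.
  have h2 : (k * (n %/ M))%:R * 4 <= alpha * n%:R.
    have q1 : (k * (n %/ M) * 4 * t <= n)%N.
      apply: leq_trans (leq_divM n M); rewrite [(k * _)%N]mulnC -!mulnA leq_mul2l.
      by apply/orP; right; rewrite mulnCA mulnA /M leq_mul2l leqnSn orbT.
    have : (k * (n %/ M) * 4 * t)%:R <= n%:R :> R by rewrite ler_nat.
    rewrite (natrM _ _ t) (natrM _ _ 4); set A := (k * _)%:R => q2.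
    have A0 : 0 <= A by apply: ler0n.
    apply: le_trans (_ : alpha * (A * 4 * t%:R) <= _); last by rewrite ler_pM2l.
    by rewrite mulrCA -[leLHS]mulr1 ler_wpM2l // mulr_ge0.
  have h3 : k%:R * 2 <= alpha * n%:R.
    have : (2 * k * t)%:R <= n%:R :> R by rewrite ler_nat.
    rewrite (natrM _ _ t) (natrM _ 2) => q2.
    apply: le_trans (_ : alpha * (2 * k%:R * t%:R) <= _); last by rewrite ler_pM2l.
    by rewrite mulrCA [k%:R * 2]mulrC -[leLHS]mulr1 ler_wpM2l // mulr_ge0.
  rewrite mulnS natrD; lra.
exact: bound.
Unshelve. all: by end_near.
Qed.
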